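(* If the algebraic quantum group $(A,\Delta)$ is co-amenable, then the dual algebraic quantum group $(\hat A,\hat\Delta)$ is amenable.
   Context: Algebras are associative over $\mathbf C$, not necessarily unital. $\otimes$ is the algebraic tensor product for $*$-algebras, the Hilbert space tensor product for Hilbert spaces, the minimal tensor product for C*-algebras; $\bar\otimes$ is the von Neumann algebra tensor product; $\iota$ is an identity map. A non-zero algebra $A$ is non-degenerate if $a=0$ whenever $ab=0$ for all $b$, or $ba=0$ for all $b$. For a non-degenerate $*$-algebra $A$, $M(A)$ is the unital $*$-algebra of linear maps $x:A\to A$ for which there is a linear $y=x^*:A\to A$ with $x(a)^*b=a^*y(b)$ for all $a,b$; $A$ embeds in $M(A)$ by left multiplication. A homomorphism $\pi:A\to B$ of such algebras is non-degenerate if $\pi(A)B$ and $B\pi(A)$ each span $B$; it then extends uniquely to $M(A)\to M(B)$ by $\pi(x)(\pi(a)b)=\pi(xa)b$. A multiplier Hopf $*$-algebra is a pair $(A,\Delta)$, where $A$ is a non-degenerate $*$-algebra and $\Delta:A\to M(A\otimes A)$ is a non-degenerate $*$-homomorphism with $(\Delta\otimes\iota)\Delta=(\iota\otimes\Delta)\Delta$ and such that $a\otimes b\mapsto\Delta(a)(b\otimes1)$ and $a\otimes b\mapsto\Delta(a)(1\otimes b)$ define linear bijections of $A\otimes A$ onto itself. Its co-unit $\varepsilon:A\to\mathbf C$ is the unique non-zero $*$-homomorphism with $(\varepsilon\otimes\iota)\Delta(a)=(\iota\otimes\varepsilon)\Delta(a)=a$; its antipode $S$ is the unique anti-multiplicative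 linear isomorphism of $A$ with $m(S\otimes\iota)(\Delta(a)(1\otimes b))=\varepsilon(a)b=m(\iota\otimes S)((b\otimes1)\Delta(a))$, $m$ being multiplication. For a linear functional $\omega$ on $A$, $(\iota\otimes\omega)\Delta(a)\in M(A)$ is determined by $(\iota\otimes\omega)(\Delta(a))\,b=(\iota\otimes\omega)(\Delta(a)(b\otimes1))$ and $b\,(\iota\otimes\omega)(\Delta(a))=(\iota\otimes\omega)((b\otimes1)\Delta(a))$; $\omega$ is left invariant if $(\iota\otimes\omega)\Delta(a)=\omega(a)1$ for all $a$. An algebraic quantum group is a multiplier Hopf $*$-algebra admitting a non-zero left-invariant positive linear functional $\varphi$ (a left Haar integral); it is automatically faithful and unique up to a positive scalar. A GNS pair $(H,\Lambda)$ for $\varphi$: a Hilbert space $H$ and a linear map $\Lambda:A\to H$ with dense range with $(\Lambda(a),\Lambda(b))=\varphi(b^*a)$. There is a unique $*$-homomorphism $\pi:A\to B(H)$ with $\pi(a)\Lambda(b)=\Lambda(ab)$; it is faithful. $A_{\mathrm r}$ is the norm closure of $\pi(A)$ and $M$ the von Neumann algebra it generates. The multiplicative unitary $W$ on $H\otimes H$ is the unique unitary with $W((\Lambda\otimes\Lambda)(\Delta(b)(a\otimes1)))=\Lambda(a)\otimes\Lambda(b)$ for all $a,b\in A$. $\Delta_{\mathrm r}(x)=W^*(1\otimes x)W$ defines a normal unital $*$-homomorphism $\Delta_{\mathrm r}:M\to M\bar\otimes M$, satisfying $\Delta_{\mathrm r}(\pi(a))=(\pi\otimes\pi)\Delta(a)$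 for $a\in A$. Co-amenability: $(A,\Delta)$ is co-amenable if $\varepsilon$ is bounded with respect to the norm $\|a\|=\|\pi(a)\|$ on $A$. Amenability: $(A,\Delta)$ is amenable if it admits a right-invariant mean, i.e. a state $m$ on $M$ with $m((\iota\bar\otimes\omega)\Delta_{\mathrm r}(x))=\omega(1)m(x)$ for all $x\in M$, $\omega\in M_*$. Dual: $\hat A=\{a\varphi: a\in A\}\subseteq A'$ (linear functionals on $A$), where $(a\varphi)(b)=\varphi(ba)$; it is a non-degenerate $*$-algebra with $\omega_1\omega_2=(\omega_1\otimes\omega_2)\Delta$ and $\omega^*(a)=\overline{\omega(S(a)^* )}$. $\hat\Delta:\hat A\to M(\hat A\otimes\hat A)$ is the unique $*$-homomorphism with $((\omega_1\otimes1)\hat\Delta(\omega_2))(a\otimes b)=(\omega_1\otimes\omega_2)(\Delta(a)(1\otimes b))$ and $(\hat\Delta(\omega_1)(1\otimes\omega_2))(a\otimes b)=(\omega_1\otimes\omega_2)((a\otimes1)\Delta(b))$. $(\hat A,\hat\Delta)$ is an algebraic quantum group. Its von Neumann algebra is realized on the same $H$: with $\hat\Lambda(a\varphi)=\Lambda(a)$, let $\hat\pi:\hat A\to B(H)$ be the $*$-homomorphism with $\hat\pi(x)\hat\Lambda(y)=\hat\Lambda(xy)$; then $\hat M=\hat\pi(\hat A)''$, with co-multiplication $\hat\Delta_{\mathrm r}(x)=W(x\otimes1)W^*$, $\hat\Delta_{\mathrm r}:\hat M\to\hat M\bar\otimes\hat M$. Amenability of $(\hat A,\hat\Delta)$ thus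 means existence of a state $m$ on $\hat M$ with $m((\iota\bar\otimes\omega)\hat\Delta_{\mathrm r}(x))=\omega(1)m(x)$ for all $x\in\hat M$, $\omega\in\hat M_*$. *)

(* Defs.v *)
From HB Require Import structures.
From mathcomp Require Import all_boot all_order all_algebra sesquilinear.
From mathcomp Require Import complex.
From mathcomp Require Import all_classical all_reals all_analysis.

Set Implicit Arguments.
Unset Strict Implicit.
Unset Printing Implicit Defensive.

Import Order.TTheory GRing.Theory Num.Theory.
Import numFieldNormedType.Exports.

Local Open Scope classical_set_scope.
Local Open Scope ring_scope.
Local Open Scope quotient_scope.

(* [tensor A B] is the quotient of the formal sums of pairs [(a, b)] by the
   relation "every bilinear map takes the same value on both sums": this is the
   universal property of the algebraic tensor product. *)
Section Tensor.
Variables (C : numClosedFieldType) (A B : lmodType C).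
Implicit Types (s : seq (A * B)).

Definition bilinear_sum (V : lmodType C) (f : A -> B -> V) s : V :=
  \sum_(p <- s) f p.1 p.2.

Definition tensor_eqv s s' : bool :=
  `[< forall (V : lmodType C) (f : A -> B -> V), bilinear_for *:%R *:%R f ->
      bilinear_sum f s = bilinear_sum f s' >].

Lemma tensor_eqv_refl : reflexive tensor_eqv.
Proof. by move=> s; apply/asboolP. Qed.

Lemma tensor_eqv_sym : symmetric tensor_eqv.
Proof. by move=> s s'; apply/asboolP/asboolP => e V f fP; rewrite e. Qed.

Lemma tensor_eqv_trans : transitive tensor_eqv.
Proof.
by move=> s' s s'' /asboolP e /asboolP e'; apply/asboolP => V f fP; rewrite e ?e'.
Qed.

Canonical tensor_equiv :=
  EquivRel tensor_eqv tensor_eqv_refl tensor_eqv_sym tensor_eqv_trans.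

Definition tensor := {eq_quot tensor_equiv}.
HB.instance Definition _ : EqQuotient _ tensor_equiv tensor :=
  EqQuotient.on tensor.
HB.instance Definition _ := Choice.on tensor.

Definition tens (a : A) (b : B) : tensor := \pi_tensor [:: (a, b)].

(* The linear map induced by [f]; meaningful when [f] is bilinear. *)
Definition tlift (V : lmodType C) (f : A -> B -> V) (x : tensor) : V :=
  bilinear_sum f (repr x).

Lemma tlift_pi (V : lmodType C) (f : A -> B -> V) s :
  bilinear_for *:%R *:%R f -> tlift f (\pi_tensor s) = bilinear_sum f s.
Proof.
move=> fP; have /eqmodP/asboolP : repr (\pi_tensor s) = s %[mod tensor].
  by rewrite reprK.
exact.
Qed.

Lemma tensor_ext (x y : tensor) :
  (forall (V : lmodType C) (f : A -> B -> V), bilinear_for *:%R *:%R f ->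
    tlift f x = tlift f y) -> x = y.
Proof.
by move=> xy; rewrite -[x]reprK -[y]reprK; apply/eqmodP/asboolP.
Qed.

Definition tensor0 : tensor := \pi_tensor [::].
Definition tensorD (x y : tensor) : tensor := \pi_tensor (repr x ++ repr y).
Definition tensorZ (k : C) (x : tensor) : tensor :=
  \pi_tensor [seq (k *: p.1, p.2) | p <- repr x].
Definition tensorN (x : tensor) : tensor := tensorZ (-1) x.

Section Lift.
Variables (V : lmodType C) (f : A -> B -> V).
Hypothesis fP : bilinear_for *:%R *:%R f.

Lemma tlift0_ : tlift f tensor0 = 0.
Proof. by rewrite tlift_pi // /bilinear_sum big_nil. Qed.

Lemma tliftD_ x y : tlift f (tensorD x y) = tlift f x + tlift f y.
Proof. by rewrite tlift_pi // /bilinear_sum big_cat. Qed.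

Lemma bilinear_forZl (k : C) a b : f (k *: a) b = k *: f a b.
Proof.
have f0 : f 0 b = 0.
  by have /= := fP.1 b (-1) 0 0; rewrite scaler0 addr0 scaleN1r addNr.
by have /= := fP.1 b k a 0; rewrite addr0 f0 addr0.
Qed.

Lemma tliftZ_ k x : tlift f (tensorZ k x) = k *: tlift f x.
Proof.
rewrite tlift_pi // /tlift /bilinear_sum big_map scaler_sumr.
by apply: eq_bigr => p _; rewrite bilinear_forZl.
Qed.

Lemma tlift_tens a b : tlift f (tens a b) = f a b.
Proof. by rewrite tlift_pi // /bilinear_sum big_seq1. Qed.
End Lift.

Lemma tensorA : associative tensorD.
Proof. by move=> x y z; apply: tensor_ext => V f fP; rewrite !tliftD_ ?addrA. Qed.
Lemma tensorC : commutative tensorD.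
Proof. by move=> x y; apply: tensor_ext => V f fP; rewrite !tliftD_ // addrC. Qed.
Lemma tensor_add0 : left_id tensor0 tensorD.
Proof. by move=> x; apply: tensor_ext => V f fP; rewrite tliftD_ // tlift0_ ?add0r. Qed.
Lemma tensor_addN : left_inverse tensor0 tensorN tensorD.
Proof.
move=> x; apply: tensor_ext => V f fP.
by rewrite tliftD_ // tliftZ_ // tlift0_ // scaleN1r addNr.
Qed.
HB.instance Definition _ :=
  GRing.isZmodule.Build tensor tensorA tensorC tensor_add0 tensor_addN.

Lemma tensor_scaleA a b (x : tensor) : tensorZ a (tensorZ b x) = tensorZ (a * b) x.
Proof. by apply: tensor_ext => V f fP; rewrite !tliftZ_ // scalerA. Qed.
Lemma tensor_scale1 : left_id 1 tensorZ.
Proof. by move=> x; apply: tensor_ext => V f fP; rewrite tliftZ_ // scale1r. Qed.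
Lemma tensor_scaleDr : right_distributive tensorZ +%R.
Proof.
by move=> k x y; apply: tensor_ext => V f fP; rewrite !(tliftZ_, tliftD_) // scalerDr.
Qed.
Lemma tensor_scaleDl (x : tensor) : {morph tensorZ^~ x : a b / a + b}.
Proof.
by move=> a b; apply: tensor_ext => V f fP; rewrite !(tliftZ_, tliftD_) // scalerDl.
Qed.
HB.instance Definition _ := GRing.Zmodule_isLmodule.Build C tensor
  tensor_scaleA tensor_scale1 tensor_scaleDr tensor_scaleDl.

Lemma tlift_linear (V : lmodType C) (f : A -> B -> V) :
  bilinear_for *:%R *:%R f -> linear (tlift f).
Proof. by move=> fP k x y; rewrite tliftD_ // tliftZ_. Qed.

Lemma tlift_comb (V : lmodType C) (f g h : A -> B -> V) (k : C) (x : tensor) :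
  (forall a b, h a b = k *: f a b + g a b) ->
  tlift h x = k *: tlift f x + tlift g x.
Proof.
move=> e; rewrite /tlift /bilinear_sum scaler_sumr -big_split.
by apply: eq_bigr => p _; rewrite e.
Qed.

Lemma tens_bilinear : bilinear_for *:%R *:%R tens.
Proof.
by split=> [b|a] k u v; apply: tensor_ext => V f fP;
  rewrite tlift_linear // !tlift_tens // (fP.1, fP.2).
Qed.

Lemma tens_sum (x : tensor) : x = \sum_(p <- repr x) tens p.1 p.2.
Proof.
have e s : \pi_tensor s = \sum_(p <- s) tens p.1 p.2.
  elim: s => [|p s IH]; first by rewrite big_nil.
  rewrite big_cons -IH; apply: tensor_ext => V f fP.
  by rewrite tliftD_ // tlift_tens // !tlift_pi // /bilinear_sum big_cons.
by rewrite -{1}[x]reprK e.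
Qed.

Lemma tens_ind (P : tensor -> Prop) :
  P 0 -> (forall x y, P x -> P y -> P (x + y)) -> (forall a b, P (tens a b)) ->
  forall x, P x.
Proof. by move=> P0 PD Pt x; rewrite [x]tens_sum; apply: big_ind. Qed.
End Tensor.

Notation "a \ox b" := (tens a b) (at level 40, left associativity) : ring_scope.

Definition tmap (C : numClosedFieldType) (A A' B B' : lmodType C)
    (f : A -> A') (g : B -> B') : tensor A B -> tensor A' B' :=
  tlift (fun a b => f a \ox g b).

Definition tassoc (C : numClosedFieldType) (A B D : lmodType C) :
    tensor (tensor A B) D -> tensor A (tensor B D) :=
  tlift (fun x d => tlift (fun a b => a \ox (b \ox d)) x).

HB.mixin Record isStarAlgebra (C : numClosedFieldType) A of GRing.Lmodule C A := {
  amul : A -> A -> A;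
  star : A -> A;
  amulA : associative amul;
  amul_bilinear : bilinear_for *:%R *:%R amul;
  starK : involutive star;
  starM : forall a b, star (amul a b) = amul (star b) (star a);
  star_antilinear : forall (k : C) a b, star (k *: a + b) = k^* *: star a + star b
}.

#[short(type="starAlgType")]
HB.structure Definition StarAlgebra (C : numClosedFieldType) :=
  { A of GRing.Lmodule C A & isStarAlgebra C A }.

Notation "a ** b" := (amul a b) (at level 40, left associativity) : ring_scope.

(* The complex conjugate of a vector space; used to extend the antilinear
   involution to tensor products. *)
Section ConjModule.
Variables (C : numClosedFieldType) (V : lmodType C).
Definition conjmod : Type := V.
HB.instance Definition _ := GRing.Zmodule.on conjmod.
Definition conjZ (k : C) (v : conjmod) : conjmod := (k^* *: (v : V)).
Lemma conjZA a b v : conjZ a (conjZ b v) = conjZ (a * b) v.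
Proof. by rewrite /conjZ scalerA rmorphM. Qed.
Lemma conjZ1 : left_id 1 conjZ.
Proof. by move=> v; rewrite /conjZ conjC1 scale1r. Qed.
Lemma conjZDr : right_distributive conjZ +%R.
Proof. by move=> k u v; rewrite /conjZ scalerDr. Qed.
Lemma conjZDl v : {morph conjZ^~ v : a b / a + b}.
Proof. by move=> a b; rewrite /conjZ rmorphD scalerDl. Qed.
HB.instance Definition _ :=
  GRing.Zmodule_isLmodule.Build C conjmod conjZA conjZ1 conjZDr conjZDl.
End ConjModule.

Section TensorStarAlgebra.
Variables (C : numClosedFieldType) (A B : starAlgType C).
Local Notation T := (tensor A B).

Definition tensor_mul (x y : T) : T :=
  tlift (fun a b => tlift (fun c d => (a ** c) \ox (b ** d)) y) x.
Definition tensor_star (x : T) : T :=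
  \sum_(p <- repr x) star p.1 \ox star p.2.

Lemma tmul_bilinear_r (a : A) (b : B) :
  bilinear_for *:%R *:%R (fun c d => (a ** c) \ox (b ** d)).
Proof.
split=> [d|c] k u v /=.
- have /= -> := amul_bilinear.2 a k u v.
  by have /= -> := (tens_bilinear A B).1 (b ** d) k (a ** u) (a ** v).
- have /= -> := amul_bilinear.2 b k u v.
  by have /= -> := (tens_bilinear A B).2 (a ** c) k (b ** u) (b ** v).
Qed.

Lemma tmul_bilinear_l (y : T) : bilinear_for *:%R *:%R
  (fun (a : A) (b : B) => tlift (fun c d => (a ** c) \ox (b ** d)) y).
Proof.
split=> [b|a] k u v /=; apply: tlift_comb => c d.
- have /= -> := amul_bilinear.1 c k u v.
  by have /= -> := (tens_bilinear A B).1 (b ** d) k (u ** c) (v ** c).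
- have /= -> := amul_bilinear.1 d k u v.
  by have /= -> := (tens_bilinear A B).2 (a ** c) k (u ** d) (v ** d).
Qed.

Lemma tensor_mulE a b c d :
  tensor_mul (a \ox b) (c \ox d) = (a ** c) \ox (b ** d).
Proof.
rewrite /tensor_mul tlift_tens; last exact: tmul_bilinear_l.
by rewrite tlift_tens //; exact: tmul_bilinear_r.
Qed.

Lemma tensor_mul_bilinear : bilinear_for *:%R *:%R tensor_mul.
Proof.
split=> [y|x] k u v; first exact: (tlift_linear (tmul_bilinear_l y)).
by apply: tlift_comb => a b; exact: (tlift_linear (tmul_bilinear_r a b)).
Qed.

Lemma tensor_mulDl x y z : tensor_mul (x + y) z = tensor_mul x z + tensor_mul y z.
Proof. by have /= := tensor_mul_bilinear.1 z 1 x y; rewrite !scale1r. Qed.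
Lemma tensor_mulDr x y z : tensor_mul x (y + z) = tensor_mul x y + tensor_mul x z.
Proof. by have /= := tensor_mul_bilinear.2 x 1 y z; rewrite !scale1r. Qed.
Lemma tensor_mul0l x : tensor_mul 0 x = 0.
Proof. by apply: (addrI (tensor_mul 0 x)); rewrite -tensor_mulDl !addr0. Qed.
Lemma tensor_mul0r x : tensor_mul x 0 = 0.
Proof. by apply: (addrI (tensor_mul x 0)); rewrite -tensor_mulDr !addr0. Qed.

Lemma tensor_mulA : associative tensor_mul.
Proof.
move=> x y z.
elim/tens_ind: x => [|x x' IHx IHx'|a b]; first by rewrite !tensor_mul0l.
  by rewrite !tensor_mulDl IHx IHx'.
elim/tens_ind: y => [|y y' IHy IHy'|c d]; first by rewrite !(tensor_mul0l, tensor_mul0r).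
  by rewrite !(tensor_mulDl, tensor_mulDr) IHy IHy'.
elim/tens_ind: z => [|z z' IHz IHz'|e f]; first by rewrite !(tensor_mul0l, tensor_mul0r).
  by rewrite !(tensor_mulDl, tensor_mulDr) IHz IHz'.
by rewrite !tensor_mulE !amulA.
Qed.

Lemma tstar_bilinear : bilinear_for *:%R *:%R
  (fun (a : A) (b : B) => (star a \ox star b : conjmod T)).
Proof.
by split=> [b|a] k u v; rewrite star_antilinear;
  [rewrite (tens_bilinear _ _).1|rewrite (tens_bilinear _ _).2].
Qed.

Lemma tensor_star_lift x :
  tensor_star x = tlift (fun a b => (star a \ox star b : conjmod T)) x.
Proof. by []. Qed.

Lemma tensor_starE a b : tensor_star (a \ox b) = star a \ox star b.
Proof. by rewrite tensor_star_lift tlift_tens //; exact: tstar_bilinear. Qed.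

Lemma tensor_star_antilinear (k : C) (x y : T) :
  tensor_star (k *: x + y) = k^* *: tensor_star x + tensor_star y.
Proof. by rewrite !tensor_star_lift tlift_linear //; exact: tstar_bilinear. Qed.

Lemma tensor_starD x y : tensor_star (x + y) = tensor_star x + tensor_star y.
Proof. by have /= := tensor_star_antilinear 1 x y; rewrite conjC1 !scale1r. Qed.
Lemma tensor_star0 : tensor_star 0 = 0.
Proof. by apply: (addrI (tensor_star 0)); rewrite -tensor_starD !addr0. Qed.

Lemma tensor_starK : involutive tensor_star.
Proof.
move=> x; elim/tens_ind: x => [|x y IHx IHy|a b]; first by rewrite !tensor_star0.
  by rewrite !tensor_starD IHx IHy.
by rewrite !tensor_starE !starK.
Qed.

Lemma tensor_starM x y :
  tensor_star (tensor_mul x y) = tensor_mul (tensor_star y) (tensor_star x).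
Proof.
elim/tens_ind: x => [|x x' IHx IHx'|a b].
- by rewrite tensor_mul0l !tensor_star0 tensor_mul0r.
- by rewrite tensor_mulDl !tensor_starD tensor_mulDr IHx IHx'.
elim/tens_ind: y => [|y y' IHy IHy'|c d].
- by rewrite tensor_mul0r !tensor_star0 tensor_mul0l.
- by rewrite tensor_mulDr !tensor_starD tensor_mulDl IHy IHy'.
by rewrite !(tensor_mulE, tensor_starE) !starM.
Qed.

HB.instance Definition _ := isStarAlgebra.Build C T tensor_mulA
  tensor_mul_bilinear tensor_starK tensor_starM tensor_star_antilinear.
End TensorStarAlgebra.

Section MultiplierHopf.
Variable C : numClosedFieldType.

Definition nondegenerate (A : starAlgType C) : Prop :=
  [/\ exists a : A, a != 0,
      forall a : A, (forall b, a ** b = 0) -> a = 0 &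
      forall a : A, (forall b, b ** a = 0) -> a = 0].

(* An element of M(A), stored together with its adjoint, which is unique when
   [A] is non-degenerate.  Elements of M(A) are compared as maps on [A]. *)
Record multiplier (A : starAlgType C) := Multiplier {
  mulop :> A -> A;
  madj : A -> A;
  mulop_linear : linear mulop;
  madj_linear : linear madj;
  madjP : forall a b, star (mulop a) ** b = star a ** madj b
}.

(* The product [b x], which lies in [A] for [b] in [A] and [x] in M(A). *)
Definition rmult (A : starAlgType C) (b : A) (x : multiplier A) : A :=
  star (madj x (star b)).

(* The map [f : A -> A], acting as a multiplier, is the element [a] of [A]. *)
Definition is_lmul (A : starAlgType C) (a : A) (f : A -> A) : Prop :=
  forall b, a ** b = f b.

Definition spans (V : lmodType C) (X : set V) : Prop :=
  forall v, exists s : seq (C * V),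
    (forall p, p \in s -> X p.2) /\ v = \sum_(p <- s) p.1 *: p.2.

Record nondegenerate_star_hom (A B : starAlgType C) (f : A -> multiplier B) :
    Prop := NondegenerateStarHom {
  nsh_linear : forall k a b s, f (k *: a + b) s = k *: f a s + f b s;
  nsh_mul : forall a b s, f (a ** b) s = f a (f b s);
  nsh_star : forall a s, f (star a) s = madj (f a) s;
  nsh_spanl : spans [set s | exists a t, s = f a t];
  nsh_spanr : spans [set s | exists a t, s = rmult t (f a)]
}.

(* For a non-degenerate homomorphism [f : A -> M(B)], given through its action
   on [B], and for [x] in M(A): [z] is the value at [x] of the extension of [f]
   to M(A). *)
Definition extends_at (A B : starAlgType C) (f : A -> B -> B)
    (x : A -> A) (z : B -> B) : Prop :=
  forall a b, z (f a b) = f (x a) b.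

Section Comultiplication.
Variables (A : starAlgType C) (Delta : A -> multiplier (tensor A A)).

(* Left multiplication by [b \ox 1] and by [1 \ox b] on [A \ox A]. *)
Definition mul_l1 (b : A) : tensor A A -> tensor A A := tmap (amul b) idfun.
Definition mul_1r (b : A) : tensor A A -> tensor A A := tmap idfun (amul b).

(* The actions of [(Delta \ox id) s] on [(A \ox A) \ox A] and of
   [(id \ox Delta) s] on [A \ox (A \ox A)]. *)
Definition Delta_id (s : tensor A A) (u : tensor (tensor A A) A) :
    tensor (tensor A A) A :=
  tlift (fun a b => tmap (Delta a) (amul b) u) s.
Definition id_Delta (s : tensor A A) (u : tensor A (tensor A A)) :
    tensor A (tensor A A) :=
  tlift (fun a b => tmap (amul a) (Delta b) u) s.

Definition coassociative : Prop := forall a,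
  exists (z : multiplier (tensor (tensor A A) A))
         (z' : multiplier (tensor A (tensor A A))),
    [/\ extends_at Delta_id (Delta a) z,
        extends_at id_Delta (Delta a) z' &
        forall u, tassoc (z u) = z' (tassoc u)].

Record multiplier_Hopf : Prop := MultiplierHopf {
  mH_nondeg : nondegenerate A;
  mH_hom : nondegenerate_star_hom Delta;
  mH_coassoc : coassociative;
  mH_bij_l : exists F : {linear tensor A A -> tensor A A}, bijective F /\
    forall a b, is_lmul (F (a \ox b)) (Delta a \o mul_l1 b);
  mH_bij_r : exists F : {linear tensor A A -> tensor A A}, bijective F /\
    forall a b, is_lmul (F (a \ox b)) (Delta a \o mul_1r b)
}.

Definition slice_l (w : A -> C) : tensor A A -> A :=
  tlift (fun a b => w a *: b).
Definition slice_r (w : A -> C) : tensor A A -> A :=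
  tlift (fun a b => w b *: a).

Record counit (eps : {scalar A}) : Prop := Counit {
  counit_neq0 : exists a, eps a != 0;
  counitM : forall a b, eps (a ** b) = eps a * eps b;
  counit_star : forall a, eps (star a) = (eps a)^*;
  counit_idl : forall a,
    extends_at (fun s => amul (slice_l eps s)) (Delta a) (amul a);
  counit_idr : forall a,
    extends_at (fun s => amul (slice_r eps s)) (Delta a) (amul a)
}.

Record antipode (eps : {scalar A}) (S : {linear A -> A}) : Prop := Antipode {
  antipode_bij : bijective S;
  antipodeM : forall a b, S (a ** b) = S b ** S a;
  antipode_l : forall a b t, is_lmul t (Delta a \o mul_1r b) ->
    tlift (fun c d => S c ** d) t = eps a *: b;
  antipode_r : forall a b t, is_lmul t (mul_l1 b \o Delta a) ->
    tlift (fun c d => c ** S d) t = eps a *: b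
}.

(* [(id \ox w)(Delta a) = w a 1] in M(A): the two clauses give the left and the
   right action of this multiplier on [b]. *)
Definition left_invariant (w : A -> C) : Prop := forall a b t,
  (is_lmul t (Delta a \o mul_l1 b) -> slice_r w t = w a *: b) /\
  (is_lmul t (mul_l1 b \o Delta a) -> slice_r w t = w a *: b).

Record left_Haar_integral (phi : {scalar A}) : Prop := LeftHaarIntegral {
  Haar_neq0 : exists a, phi a != 0;
  Haar_ge0 : forall a, 0 <= phi (star a ** a);
  Haar_invariant : left_invariant phi
}.

Section Dual.
Variables (phi : {scalar A}) (S : A -> A).

(* The functional [a phi], and the underlying set of the dual. *)
Definition dual_elt (a : A) : A -> C := fun b => phi (b ** a).
Definition dual_carrier : set (A -> C) := range dual_elt.

Definition phi_phi : tensor A A -> C :=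
  tlift (fun a b => (phi a * phi b : C^o)).

(* [w] is the product of [w1 = a1 phi] and [w2 = a2 phi], that is
   [(w1 \ox w2) Delta], where [w1 \ox w2] is extended to M(A \ox A) by
   [(w1 \ox w2) x = (phi \ox phi) (x (a1 \ox a2))]. *)
Definition dual_mul (w1 w2 w : A -> C) : Prop := exists a1 a2,
  [/\ w1 = dual_elt a1, w2 = dual_elt a2 &
      forall a, w a = phi_phi (Delta a (a1 \ox a2))].

Definition dual_star (w : A -> C) : A -> C := fun a => (w (star (S a)))^*.

End Dual.
End Comultiplication.
End MultiplierHopf.

Record hilbert (R : realType) := Hilbert {
  hilbert_sort :> completeNormedModType R[i];
  ip : {dot hilbert_sort for Num.conj};
  ip_norm : forall u, ip u u = `|u| ^+ 2
}.
Arguments ip {R h}.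

Section Operators.
Variables (R : realType) (H : hilbert R).
Local Notation C := R[i].
Implicit Types (T : H -> H) (M : set (H -> H)) (w : (H -> H) -> C).

Definition bounded_op T : Prop := linear T /\ continuous T.

Definition opnorm T : R := sup [set complex.Re `|T u| | u in [set u | `|u| <= 1]].

Definition adjoint T T' : Prop := forall u v, ip (T u) v = ip u (T' v).

Definition unitary T T' : Prop :=
  [/\ linear T, adjoint T T', cancel T T' & cancel T' T].

Definition commutant M : set (H -> H) :=
  [set T | bounded_op T /\ forall T', M T' -> T \o T' = T' \o T].

Record state M (m : (H -> H) -> C) : Prop := State {
  state_linear : forall k T T', M T -> M T' ->
    m (fun u => k *: T u + T' u) = k * m T + m T';
  state_ge0 : forall T, M T -> (forall u, 0 <= ip (T u) u) -> 0 <= m T;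
  state1 : m idfun = 1
}.

Definition square_summable (xi : nat -> H) : Prop :=
  cvgn (series (fun n => `|xi n| ^+ 2 : R[i]^o)).

(* On [M], [w] is [x |-> \sum_n (x xi_n, eta_n)].  The functionals of this form
   are the sigma-weakly continuous ones, i.e. the elements of the predual. *)
Definition normal_form M w (xi eta : nat -> H) : Prop :=
  [/\ square_summable xi, square_summable eta &
      forall T, M T -> series (fun n => ip (T (xi n)) (eta n) : R[i]^o) @ \oo --> (w T : R[i]^o)].

Definition predual M w : Prop := exists xi eta, normal_form M w xi eta.

End Operators.

Section TensorOperators.
Variables (R : realType) (H K : hilbert R) (t : H -> H -> K).

(* [K], with [t u v] in the role of [u \ox v], is the Hilbert space tensor
   product of [H] with itself. *)
Record hilbert_tensor : Prop := HilbertTensor {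
  ht_bilinear : bilinear_for *:%R *:%R t;
  ht_ip : forall u v u' v', ip (t u v) (t u' v') = ip u u' * ip v v';
  ht_dense : dense [set z | exists s : seq (H * H), z = \sum_(p <- s) t p.1 p.2]
}.

(* [X] is [x \ox 1]. *)
Definition ampliation (x : H -> H) (X : K -> K) : Prop :=
  bounded_op X /\ forall u v, X (t u v) = t (x u) v.

(* [y = (id \ox w) X], the Tomiyama slice map: for all vector functionals
   [w_(u,v) = (. u, v)], the number [w_(u,v) y] equals [(w_(u,v) \ox w) X]. *)
Definition slice_map (M : set (H -> H)) (w : (H -> H) -> R[i])
    (X : K -> K) (y : H -> H) : Prop :=
  bounded_op y /\ exists xi eta, normal_form M w xi eta /\
    forall u v,
      series (fun n => ip (X (t u (xi n))) (t v (eta n)) : R[i]^o) @ \oo -->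
        (ip (y u) v : R[i]^o).

(* Amenability of a von Neumann algebra [M] with comultiplication [Delta_r],
   the latter given by its graph. *)
Definition amenable (M : set (H -> H))
    (Delta_r : (H -> H) -> (K -> K) -> Prop) : Prop :=
  exists m, state M m /\
    forall x X w y, M x -> Delta_r x X -> predual M w -> slice_map M w X y ->
      m y = w idfun * m x.

End TensorOperators.

Section RegularRepresentation.
Variables (R : realType) (A : starAlgType R[i]).
Variables (Delta : A -> multiplier (tensor A A)) (phi eps : {scalar A}).
Variables (S : A -> A) (H : hilbert R) (Lambda : {linear A -> H}).

Record GNS_pair : Prop := GNSPair {
  GNS_dense : dense (range Lambda);
  GNS_ip : forall a b, ip (Lambda a) (Lambda b) = phi (star b ** a)
}.

Record GNS_representation (rep : A -> H -> H) : Prop := GNSRepresentation {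
  rep_bounded : forall a, bounded_op (rep a);
  rep_linear : forall k a b u, rep (k *: a + b) u = k *: rep a u + rep b u;
  repM : forall a b u, rep (a ** b) u = rep a (rep b u);
  rep_star : forall a, adjoint (rep a) (rep (star a));
  rep_Lambda : forall a b, rep a (Lambda b) = Lambda (a ** b)
}.

Definition coamenable (rep : A -> H -> H) : Prop :=
  exists K : R, forall a, `|eps a| <= (K * opnorm (rep a))%:C%C.

Record dual_representation (rep : (A -> R[i]) -> H -> H) : Prop :=
    DualRepresentation {
  drep_bounded : forall w, dual_carrier phi w -> bounded_op (rep w);
  drep_linear : forall k w1 w2 u, dual_carrier phi w1 -> dual_carrier phi w2 ->
    rep (fun a => k * w1 a + w2 a) u = k *: rep w1 u + rep w2 u;
  drepM : forall w1 w2 w u, dual_mul Delta phi w1 w2 w ->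
    rep w u = rep w1 (rep w2 u);
  drep_star : forall w, dual_carrier phi w ->
    adjoint (rep w) (rep (dual_star S w));
  (* with the GNS map [dual_elt phi a |-> Lambda a] of the dual: *)
  drep_Lambda : forall w b c,
    dual_mul Delta phi w (dual_elt phi b) (dual_elt phi c) ->
    rep w (Lambda b) = Lambda c
}.

Definition dual_vN (rep : (A -> R[i]) -> H -> H) : set (H -> H) :=
  commutant (commutant [set rep w | w in dual_carrier phi]).

Variables (K : hilbert R) (t : H -> H -> K) (W Wadj : K -> K).

Record multiplicative_unitary : Prop := MultiplicativeUnitary {
  mu_unitary : unitary W Wadj;
  muE : forall a b x, is_lmul x (Delta b \o mul_l1 a) ->
    W (tlift (fun c d => t (Lambda c) (Lambda d)) x) = t (Lambda a) (Lambda b)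
}.

(* [X] is [W (x \ox 1) W^*]. *)
Definition dual_comult (x : H -> H) (X : K -> K) : Prop :=
  exists x1, ampliation t x x1 /\ X = W \o x1 \o Wadj.

End RegularRepresentation.

(* Main.v *)
From HB Require Import structures.
From mathcomp Require Import all_boot all_order all_algebra sesquilinear.
From mathcomp Require Import complex.
From mathcomp Require Import all_classical all_reals all_analysis.
From mathcomp Require Import ring lra.
Require Import Defs.

Set Implicit Arguments.
Unset Strict Implicit.
Unset Printing Implicit Defensive.

Import Order.TTheory GRing.Theory Num.Theory.
Import numFieldNormedType.Exports.

Local Open Scope classical_set_scope.
Local Open Scope ring_scope.

(* Co-amenability makes [eps] a limit of vector states: if no unit vector
   [Lambda a] were almost fixed, up to the scalars [eps c], by finitely many given
   elements [c] of [A], then the powers of a strict contraction would contradict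
   the boundedness of [eps].  Let [m] be the limit of the vector states
   [x |-> (x (Lambda a), Lambda a)] along an ultrafilter of such [a].  The matrix
   coefficient [(W^* (Lambda a \ox Lambda b), Lambda a \ox Lambda b)] equals
   [(Lambda (e a), Lambda a)] with [e = (id \ox phi)((1 \ox b^* ) Delta b)], and
   [eps e = phi (b^* b)]; as [W^*] is isometric, it follows that
   [W^* (Lambda a \ox xi) - Lambda a \ox xi] tends to 0 for every [xi].  Hence [W]
   disappears in the limit from the slices of [W (x \ox 1) W^*], which is the
   invariance of [m]. *)

(** * Linear functionals and the algebraic tensor product *)

Section Functionals.
Variables (C : numClosedFieldType) (V : lmodType C).

(** Zorn's lemma gives a maximal subspace [A] containing [W] and missing [v]. Maximality makes [V]
    the sum of [A] and the line through [v], and [f] reads off the coefficient of [v]. *)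
Lemma exists_scalar (W : set V) (v : V) :
  W 0 -> (forall k x y, W x -> W y -> W (k *: x + y)) -> ~ W v ->
  exists f : V -> C, [/\ scalar f, forall x, W x -> f x = 0 & f v = 1].
Proof.
move=> W0 Wlin Wv.
pose P (U : set V) := [/\ forall k x y, U x -> U y -> U (k *: x + y), ~ U v &
  U = set0 \/ W `<=` U].
have [|A [[Alin Av AW] Amax]] := @Zorn_bigcup V P.
  move=> F FP Ftot; split.
  - move=> k x y [X FX Xx] [Y FY Yy].
    have [XY|YX] := Ftot _ _ FX FY.
      by exists Y => //; have [h _ _] := FP _ FY; apply: h => //; exact: XY.
    by exists X => //; have [h _ _] := FP _ FX; apply: h => //; exact: YX.
  - by move=> [X FX Xv]; have [_ + _] := FP _ FX; apply.
  - have [->|/set0P [x [X FX Xx]]] := eqVneq (\bigcup_(X in F) X) set0; first by left.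
    right; have [_ _ []] := FP _ FX; first by move=> X0; rewrite X0 in Xx.
    by move=> WX y /WX Xy; exists X.
have {}AW : W `<=` A.
  case: AW => // A0; exfalso; apply: (Amax W); last by split => //; right.
  by rewrite A0; split; [exact: sub0set|move=> /(_ 0 W0)].
have A0 : A 0 by exact: AW.
have AZ k x : A x -> A (k *: x) by move=> Ax; rewrite -[_ *: _]addr0; exact: Alin.
have AB x y : A x -> A y -> A (x - y).
  by move=> Ax Ay; rewrite addrC -scaleN1r; exact: Alin.
have dec w : exists k, A (w - k *: v).
  have [Aw|Aw] := pselect (A w); first by exists 0; rewrite scale0r subr0.
  (* [B] is the sum of [A] and the line through [w]. If [w] is outside [A], maximality puts [v] in
     [B], and the coefficient of [w] in [v] is invertible because [v] is not in [A]. *)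
  pose B := [set x | exists k, A (x - k *: w)].
  have AB' : A `<` B.
    split=> [x Ax|BA]; first by exists 0; rewrite scale0r subr0.
    by apply/Aw/BA; exists 1; rewrite scale1r subrr.
  have [[k Ak]|nBv] := pselect (B v); last first.
    exfalso; apply: (Amax B AB'); split => //.
      move=> k x y [l Al] [l' Al']; exists (k * l + l').
      rewrite scalerDl opprD addrACA -scalerA -scalerBr; exact: Alin.
    by right => x /AW /(AB'.1).
  have k0 : k != 0.
    by apply/eqP => k0; apply: Av; move: Ak; rewrite k0 scale0r subr0.
  exists k^-1; have := AZ (- k^-1) _ Ak.
  by rewrite scalerBr scalerA mulNr mulVf // scaleN1r opprK addrC scaleNr.
have uniqk k k' w : A (w - k *: v) -> A (w - k' *: v) -> k = k'.
  move=> Ak Ak'; apply/eqP; apply: contra_notT Av => kk'.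
  have := AZ (k' - k)^-1 _ (AB _ _ Ak Ak').
  have -> : w - k *: v - (w - k' *: v) = (k' - k) *: v.
    by rewrite opprB scalerBl addrC addrA subrK.
  by rewrite scalerA mulVf ?scale1r // subr_eq0 eq_sym.
pose f w := projT1 (cid (dec w)).
have fP w : A (w - f w *: v) by rewrite /f; case: cid.
exists f; split.
- move=> k x y; apply: (uniqk _ _ (k *: x + y)) => //.
  by rewrite scalerDl opprD addrACA -scalerA -scalerBr; exact: Alin.
- by move=> x Wx; apply: (uniqk _ _ x) => //; rewrite scale0r subr0; exact: AW.
- by apply: (uniqk _ _ v) => //; rewrite scale1r subrr.
Qed.

Lemma scalar_separates (v : V) : (forall f : V -> C, scalar f -> f v = 0) -> v = 0.
Proof.
move=> v0; apply: contrapT => nv.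
have [| | |f [flin _ fv]] := @exists_scalar [set 0] v => //.
  by move=> k x y /= -> ->; rewrite scaler0 addr0.
by have := v0 f flin; rewrite fv => /eqP; rewrite oner_eq0.
Qed.
End Functionals.

Section ScalarFun.
Variables (C : numClosedFieldType) (V : lmodType C) (f : V -> C).
Hypothesis f_lin : scalar f.

Lemma scalar_fun0 : f 0 = 0.
Proof. by have := f_lin (-1) 0 0; rewrite scaler0 addr0 mulN1r addNr. Qed.

Lemma scalar_funD x y : f (x + y) = f x + f y.
Proof. by have := f_lin 1 x y; rewrite scale1r mul1r. Qed.

Lemma scalar_funZ k x : f (k *: x) = k * f x.
Proof. by have := f_lin k x 0; rewrite !addr0 scalar_fun0 addr0. Qed.
End ScalarFun.

Section TensorSlices.
Variables (C : numClosedFieldType) (A B : lmodType C).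

Lemma tliftD (V : lmodType C) (f : A -> B -> V) (x y : tensor A B) :
  bilinear_for *:%R *:%R f -> tlift f (x + y) = tlift f x + tlift f y.
Proof. by move=> fP; exact: tliftD_. Qed.

Lemma tlift0 (V : lmodType C) (f : A -> B -> V) :
  bilinear_for *:%R *:%R f -> tlift f 0 = 0.
Proof. by move=> fP; exact: tlift0_. Qed.

Lemma tlift_sum (V : lmodType C) (f : A -> B -> V) I (s : seq I) (g : I -> A)
    (h : I -> B) : bilinear_for *:%R *:%R f ->
  tlift f (\sum_(i <- s) g i \ox h i) = \sum_(i <- s) f (g i) (h i).
Proof.
move=> fP; elim: s => [|i s IH]; first by rewrite !big_nil tlift0.
by rewrite !big_cons tliftD // tlift_tens // IH.
Qed.

Lemma slice_r_bilinear (w : B -> C) : scalar w ->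
  bilinear_for *:%R *:%R (fun (a : A) b => w b *: a).
Proof.
move=> w_lin; split=> [b|a] k u v /=; first by rewrite scalerDr !scalerA mulrC.
by rewrite w_lin scalerDl scalerA.
Qed.

Lemma slice_l_bilinear (w : A -> C) : scalar w ->
  bilinear_for *:%R *:%R (fun a (b : B) => w a *: b).
Proof.
move=> w_lin; split=> [b|a] k u v /=; last by rewrite scalerDr !scalerA mulrC.
by rewrite w_lin scalerDl scalerA.
Qed.

Lemma tensDl (a a' : A) (b : B) : (a + a') \ox b = a \ox b + a' \ox b.
Proof. by have /= := (tens_bilinear A B).1 b 1 a a'; rewrite !scale1r. Qed.

Lemma tensZl k (a : A) (b : B) : (k *: a) \ox b = k *: (a \ox b).
Proof. exact: (bilinear_forZl (tens_bilinear A B)). Qed.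

Lemma tens0r (a : A) : a \ox (0 : B) = 0.
Proof.
by have /= := (tens_bilinear A B).2 a (-1) 0 0; rewrite scaler0 addr0 /= scaleN1r addNr.
Qed.

Lemma tens0l (b : B) : (0 : A) \ox b = 0.
Proof. by rewrite -(scale0r 0) tensZl scale0r. Qed.

Lemma tensZr k (a : A) (b : B) : a \ox (k *: b) = k *: (a \ox b).
Proof.
by have /= := (tens_bilinear A B).2 a k b 0; rewrite /= !addr0 tens0r addr0.
Qed.

Lemma tensDr (a : A) (b b' : B) : a \ox (b + b') = a \ox b + a \ox b'.
Proof. by have /= := (tens_bilinear A B).2 a 1 b b'; rewrite !scale1r. Qed.

(* Induction on the length of a representation of [x]: a right leg that depends
   linearly on the others can be absorbed, and an independent one is detected by
   a functional vanishing on the others. *)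
Lemma slice_r_separates (x : tensor A B) :
  (forall w : B -> C, scalar w -> tlift (fun a b => w b *: a) x = 0) -> x = 0.
Proof.
rewrite [x]tens_sum; move: (repr x) => s {x}.
have [n] := ubnP (size s); elim: n s => // n IH [|[a0 b0] s]; first by rewrite big_nil.
rewrite ltnS /= => sn xs; rewrite big_cons /=.
pose p_ i := tnth (in_tuple s) i.
pose W := [set b | exists k : 'I_(size s) -> C, b = \sum_i k i *: (p_ i).2].
have W0 : W 0.
  by exists (fun=> 0); rewrite big1 // => i _; rewrite scale0r.
have Wlin k x y : W x -> W y -> W (k *: x + y).
  move=> [l ->] [l' ->]; exists (fun i => k * l i + l' i).
  rewrite scaler_sumr -big_split; apply: eq_bigr => i _.
  by rewrite scalerDl scalerA.
have [[k b0E]|nW] := pselect (W b0).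
  pose t := [seq (k i *: a0 + (p_ i).1, (p_ i).2) | i <- index_enum 'I_(size s)].
  have tE : a0 \ox b0 + \sum_(p <- s) p.1 \ox p.2 = \sum_(p <- t) p.1 \ox p.2.
    rewrite big_map b0E [X in _ + X]big_tnth.
    have -> : a0 \ox (\sum_i k i *: (p_ i).2) = \sum_i a0 \ox (k i *: (p_ i).2).
      elim/big_ind2 : _ => // [|y y' z z' <- <-]; first exact: tens0r.
      by rewrite tensDr.
    rewrite -big_split; apply: eq_bigr => i _ /=.
    by rewrite tensDl tensZr tensZl.
  rewrite tE; apply: IH => [|w ww]; last by rewrite -tE -(xs w ww) big_cons.
  by rewrite size_map /index_enum -enumT size_enum_ord.
have [f [flin fW fb0]] := exists_scalar W0 Wlin nW.
have fs i : f (p_ i).2 = 0.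
  apply: fW; exists (fun j => (j == i)%:R).
  rewrite (bigD1 i) //= eqxx scale1r big1 ?addr0 // => j /negPf ->.
  by rewrite scale0r.
(* Only the first term survives slicing by [f], so [a0 = 0] and the induction hypothesis applies to
   [s]. *)
have := xs f flin.
rewrite tlift_sum; last exact: slice_r_bilinear.
rewrite big_cons /= fb0 scale1r big_tnth big1 ?addr0 => [a00|i _]; last first.
  by rewrite fs scale0r.
rewrite a00 tens0l add0r; apply: IH => // w ww.
by rewrite -(xs w ww) big_cons /= a00 tens0l add0r.
Qed.
End TensorSlices.

(** * Multipliers of the tensor square *)

Section StarAlgebras.
Variables (C : numClosedFieldType) (A : starAlgType C).
Implicit Types (a b c d : A) (w : A -> C).

Lemma amulDl a b c : (a + b) ** c = a ** c + b ** c.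
Proof. by have /= := amul_bilinear.1 c 1 a b; rewrite !scale1r. Qed.

Lemma amulDr a b c : c ** (a + b) = c ** a + c ** b.
Proof. by have /= := amul_bilinear.2 c 1 a b; rewrite !scale1r. Qed.

Lemma amul0 a : a ** 0 = 0.
Proof. by apply: (addrI (a ** 0)); rewrite -amulDr !addr0. Qed.

Lemma a0mul a : 0 ** a = 0.
Proof. by apply: (addrI (0 ** a)); rewrite -amulDl !addr0. Qed.

Lemma amulZl k a b : (k *: a) ** b = k *: (a ** b).
Proof. exact: (bilinear_forZl amul_bilinear). Qed.

Lemma amulZr k a b : b ** (k *: a) = k *: (b ** a).
Proof. by have /= := amul_bilinear.2 b k a 0; rewrite !addr0 amul0 addr0. Qed.

Lemma amulNl a b : (- a) ** b = - (a ** b).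
Proof. by rewrite -scaleN1r amulZl scaleN1r. Qed.

Lemma amulNr a b : b ** (- a) = - (b ** a).
Proof. by rewrite -scaleN1r amulZr scaleN1r. Qed.

Lemma starD a b : star (a + b) = star a + star b.
Proof. by have := star_antilinear 1 a b; rewrite conjC1 !scale1r. Qed.

Lemma star0 : star (0 : A) = 0.
Proof. by apply: (addrI (star 0)); rewrite -starD !addr0. Qed.

Lemma amul_scalar w a : scalar w -> scalar (fun b => w (a ** b)).
Proof. by move=> w_lin k x y; rewrite amulDr amulZr w_lin. Qed.

End StarAlgebras.

Section TensorSquare.
Variables (C : numClosedFieldType) (A : starAlgType C).
Implicit Types (a b c d : A) (s z p : tensor A A) (w : A -> C).

Lemma slice_rD w s z : scalar w -> slice_r w (s + z) = slice_r w s + slice_r w z.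
Proof. by move=> w_lin; exact: tliftD (slice_r_bilinear _ w_lin). Qed.

Lemma slice_r0 w : scalar w -> slice_r w (0 : tensor A A) = 0.
Proof. by move=> w_lin; exact: tlift0 (slice_r_bilinear _ w_lin). Qed.

Lemma slice_rE w a b : scalar w -> slice_r w (a \ox b) = w b *: a.
Proof. by move=> w_lin; exact: tlift_tens (slice_r_bilinear _ w_lin) _ _. Qed.

Lemma slice_lD w s z : scalar w -> slice_l w (s + z) = slice_l w s + slice_l w z.
Proof. by move=> w_lin; exact: tliftD (slice_l_bilinear _ w_lin). Qed.

Lemma slice_l0 w : scalar w -> slice_l w (0 : tensor A A) = 0.
Proof. by move=> w_lin; exact: tlift0 (slice_l_bilinear _ w_lin). Qed.

Lemma slice_lE w a b : scalar w -> slice_l w (a \ox b) = w a *: b.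
Proof. by move=> w_lin; exact: tlift_tens (slice_l_bilinear _ w_lin) _ _. Qed.

Lemma slice_l_mul w a b s : scalar w ->
  slice_l w ((a \ox b) ** s) = b ** slice_l (fun c => w (a ** c)) s.
Proof.
move=> w_lin; have wa_lin := amul_scalar a w_lin.
elim/tens_ind: s => [|s z IHs IHz|c d].
- by rewrite amul0 !slice_l0 // amul0.
- by rewrite amulDr !slice_lD // amulDr IHs IHz.
- by rewrite [_ ** _]tensor_mulE !slice_lE // amulZr.
Qed.

(** Both orders of slicing evaluate the product functional of [f] and [g] at [s]. *)
Lemma slice_exchange (f g : A -> C) s : scalar f -> scalar g ->
  f (slice_r g s) = g (slice_l f s).
Proof.
move=> f_lin g_lin; elim/tens_ind: s => [|s z IHs IHz|c d].
- by rewrite slice_r0 // slice_l0 // !scalar_fun0.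
- by rewrite slice_rD // slice_lD // !scalar_funD // IHs IHz.
- by rewrite slice_rE // slice_lE // !scalar_funZ // mulrC.
Qed.

(** Non-degeneracy passes to the tensor square one leg at a time. If all [(a \ox b) ** s] vanish, so
    do the left slices of [s] by the functionals [g (a ** _)]; exchanging slices, every
    [g (a ** slice_r f s)] is 0, hence so is every right slice of [s]. *)
Lemma tensor_lcancel s z : nondegenerate A ->
  (forall p, p ** s = p ** z) -> s = z.
Proof.
move=> [_ _ ndr] sz; apply/eqP; rewrite -subr_eq0; apply/eqP.
have {sz} sz0 p : p ** (s - z) = 0 by rewrite amulDr amulNr sz subrr.
move: (s - z) sz0 => {z}s s0; apply: slice_r_separates => f f_lin.
apply: (ndr) => a; apply: scalar_separates => g g_lin.
have ga_lin := amul_scalar a g_lin.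
have := slice_exchange s ga_lin f_lin => /= ->.
suff -> : slice_l (fun b => g (a ** b)) s = 0 by exact: scalar_fun0.
by apply: ndr => b; rewrite -slice_l_mul // s0 slice_l0.
Qed.

Lemma tensor_rcancel s z : nondegenerate A ->
  (forall p, s ** p = z ** p) -> s = z.
Proof.
move=> nd sz; rewrite -[s]starK -[z]starK; congr star.
by apply: (tensor_lcancel nd) => p; rewrite -[p]starK -!starM sz.
Qed.

Lemma tmap_bilinear (f g : A -> A) : linear f -> linear g ->
  bilinear_for *:%R *:%R (fun a b => f a \ox g b).
Proof.
move=> f_lin g_lin; split=> [b|a] k x y /=.
  by rewrite f_lin tensDl tensZl.
by rewrite g_lin tensDr tensZr.
Qed.

Lemma tmapD (f g : A -> A) s z : linear f -> linear g ->
  tmap f g (s + z) = tmap f g s + tmap f g z.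
Proof. by move=> fl gl; exact: tliftD (tmap_bilinear fl gl). Qed.

Lemma tmap0 (f g : A -> A) : linear f -> linear g -> tmap f g 0 = 0.
Proof. by move=> fl gl; exact: tlift0 (tmap_bilinear fl gl). Qed.

Lemma tmapE (f g : A -> A) a b : linear f -> linear g ->
  tmap f g (a \ox b) = f a \ox g b.
Proof. by move=> fl gl; exact: tlift_tens (tmap_bilinear fl gl) _ _. Qed.

Lemma amul_linear a : linear (amul a).
Proof. by move=> k x y; rewrite amulDr amulZr. Qed.

Lemma amulr_linear a : linear (fun b => b ** a).
Proof. by move=> k x y; rewrite amulDl amulZl. Qed.

Lemma idfun_linear : linear (idfun : A -> A).
Proof. by []. Qed.
Local Hint Resolve amul_linear amulr_linear idfun_linear : core.

(* The product [s (a \ox 1)]. *)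
Definition mulr_l1 a : tensor A A -> tensor A A := tmap (fun b => b ** a) idfun.

Lemma star_mul_1r c s z : star (mul_1r c s) ** z = star s ** mul_1r (star c) z.
Proof.
rewrite /mul_1r.
elim/tens_ind: s => [|s p IHs IHp|a b].
- by rewrite tmap0 // star0 !a0mul.
- by rewrite tmapD // !starD !amulDl IHs IHp.
elim/tens_ind: z => [|z p IHz IHp|a' b'].
- by rewrite tmap0 // !amul0.
- by rewrite tmapD // !amulDr IHz IHp.
rewrite !tmapE // ![star (_ \ox _)]tensor_starE.
by rewrite ![_ ** (_ \ox _)]tensor_mulE starM amulA.
Qed.

Lemma mul_1r_mul c s z : mul_1r c (s ** z) = mul_1r c s ** z.
Proof.
rewrite /mul_1r.
elim/tens_ind: s => [|s p IHs IHp|a b].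
- by rewrite a0mul tmap0 // a0mul.
- by rewrite amulDl !tmapD // amulDl IHs IHp.
elim/tens_ind: z => [|z p IHz IHp|a' b'].
- by rewrite amul0 tmap0 // amul0.
- by rewrite !amulDr tmapD // IHz IHp.
by rewrite [_ ** _]tensor_mulE !tmapE // [_ ** (_ \ox _)]tensor_mulE amulA.
Qed.

Lemma mulr_l1_mul a s z : mulr_l1 a s ** z = s ** mul_l1 a z.
Proof.
rewrite /mulr_l1 /mul_l1.
elim/tens_ind: s => [|s p IHs IHp|c d].
- by rewrite tmap0 // !a0mul.
- by rewrite tmapD // !amulDl IHs IHp.
elim/tens_ind: z => [|z p IHz IHp|c' d'].
- by rewrite tmap0 // !amul0.
- by rewrite tmapD // !amulDr IHz IHp.
by rewrite !tmapE // ![_ ** (_ \ox _)]tensor_mulE amulA.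
Qed.

Lemma slice_r_mulr_l1 w a s : scalar w ->
  slice_r w (mulr_l1 a s) = slice_r w s ** a.
Proof.
move=> w_lin; rewrite /mulr_l1; elim/tens_ind: s => [|s p IHs IHp|c d].
- by rewrite tmap0 // slice_r0 // a0mul.
- by rewrite tmapD // !slice_rD // amulDl IHs IHp.
- by rewrite tmapE // !slice_rE // amulZl.
Qed.

Lemma slice_l_mul_1r w c s : scalar w ->
  slice_l w (mul_1r c s) = c ** slice_l w s.
Proof.
move=> w_lin; rewrite /mul_1r; elim/tens_ind: s => [|s p IHs IHp|a b].
- by rewrite tmap0 // slice_l0 // amul0.
- by rewrite tmapD // !slice_lD // amulDr IHs IHp.
- by rewrite tmapE // !slice_lE // amulZr.
Qed.

Lemma slice_l_hom w s z : scalar w -> (forall a b, w (a ** b) = w a * w b) ->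
  slice_l w (s ** z) = slice_l w s ** slice_l w z.
Proof.
move=> w_lin wM; elim/tens_ind: s => [|s p IHs IHp|a b].
- by rewrite a0mul slice_l0 // a0mul.
- by rewrite amulDl !slice_lD // amulDl IHs IHp.
rewrite slice_l_mul // slice_lE // amulZl -amulZr; congr amul.
elim/tens_ind: z => [|z p IHz IHp|c d].
- by rewrite !slice_l0 ?scaler0 //; exact: amul_scalar.
- by rewrite !slice_lD ?scalerDr ?IHz ?IHp //; exact: amul_scalar.
- by rewrite !slice_lE ?wM ?scalerA //; exact: amul_scalar.
Qed.

(** Evaluating on [(d \ox c) ** s] with the second leg sliced first turns a two-variable matrix
    coefficient into a value of [w] on [A]. *)
Lemma tlift_scalars (w v : A -> C) c d s : scalar w -> scalar v ->
  tlift (fun a b => w (d ** a) * v (c ** b) : C^o) s =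
  w (d ** slice_r v (mul_1r c s)).
Proof.
move=> w_lin v_lin; have wd_lin := amul_scalar d w_lin.
have vc_lin := amul_scalar c v_lin.
have bil : bilinear_for *:%R *:%R (fun a b => w (d ** a) * v (c ** b) : C^o).
  split=> [b|a] k x y /=.
    by rewrite wd_lin mulrDl -mulrA.
  by rewrite vc_lin mulrDr mulrCA.
rewrite /mul_1r; elim/tens_ind: s => [|s p IHs IHp|a b].
- by rewrite tlift0 // tmap0 // slice_r0 // amul0 scalar_fun0.
- by rewrite tliftD // tmapD // slice_rD // amulDr scalar_funD // IHs IHp.
- by rewrite tlift_tens // tmapE // slice_rE // amulZr scalar_funZ // mulrC.
Qed.
End TensorSquare.

(** * Slices of the comultiplication *)

Section Comultiplication.
Variables (C : numClosedFieldType) (A : starAlgType C).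
Variables (Delta : A -> multiplier (tensor A A)).
Hypothesis Delta_mH : multiplier_Hopf Delta.

(* [y] is [(1 \ox c^* ) Delta b]. *)
Lemma comult_cut (b c : A) : exists y : tensor A A,
  forall z, y ** z = mul_1r (star c) (Delta b z).
Proof.
have [F [_ FE]] := mH_bij_r Delta_mH.
(* [F (star b \ox c)] is [Delta (star b) (1 \ox c)]; its adjoint is the required element. *)
exists (star (F (star b \ox c))) => z.
apply: (tensor_lcancel (mH_nondeg Delta_mH)) => p.
rewrite -[p]starK amulA -starM FE madjP.
by rewrite -(nsh_star (mH_hom Delta_mH)) starK star_mul_1r.
Qed.

Variables (phi eps : {scalar A}).
Hypothesis eps_counit : counit Delta eps.

Lemma counit1 : exists a, eps a = 1.
Proof.
have [a a0] := counit_neq0 eps_counit; exists ((eps a)^-1 *: a).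
by rewrite linearZ /= mulVf.
Qed.

(* [e] is [(id \ox phi)((1 \ox c^* ) Delta b)]. *)
Lemma comult_slice (b c : A) : exists e : A, eps e = phi (star c ** b) /\
  forall a d x, is_lmul x (Delta b \o mul_l1 a) ->
    tlift (fun u v => phi (star d ** u) * phi (star c ** v) : C^o) x =
    phi (star d ** (e ** a)).
Proof.
have phi_lin : scalar phi := linearP phi.
have eps_lin : scalar eps := linearP eps.
have nd := mH_nondeg Delta_mH; have [_ ndl _] := nd.
have cancel_r u v : (forall d : A, u ** d = v ** d) -> u = v.
  move=> uv; apply/eqP; rewrite -subr_eq0; apply/eqP/ndl => d.
  by rewrite amulDl amulNl uv subrr.
have [y yE] := comult_cut b c; exists (slice_r phi y); split.
  (* [eps e] is [phi] of the left slice of [y] by [eps], and the co-unit property makes that slice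
     [star c ** b]. *)
  rewrite slice_exchange //; congr (phi _); apply: (cancel_r) => d.
  have [a0 a01] := counit1.
  have -> : d = slice_l eps (a0 \ox d) by rewrite slice_lE // a01 scale1r.
  rewrite -slice_l_hom //; last exact: (counitM eps_counit).
  rewrite yE slice_l_mul_1r // -amulA; congr amul.
  by apply: (cancel_r) => u; rewrite -(counit_idl eps_counit) amulA.
(* With [x = Delta b (a \ox 1)], cutting [x] on the left by [1 \ox star c] gives [y (a \ox 1)],
   whose slice by [phi] is [e ** a]. *)
move=> a d x xE; rewrite tlift_scalars // -slice_r_mulr_l1 //.
congr (phi (_ ** slice_r _ _)); apply: (tensor_rcancel nd) => z.
by rewrite -mul_1r_mul xE mulr_l1_mul yE.
Qed.
End Comultiplication.

(** * Operators on a complex Hilbert space *)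

Section RealNorm.
Variables (R : realType) (V : normedZmodType R[i]).
Implicit Types u v : V.

(** Norms are valued in [R[i]], which is only partially ordered; this is the same norm as a real
    number, so that real estimates apply. *)
Definition nrm u : R := complex.Re `|u|.

Lemma nrmE u : `|u| = (nrm u)%:C%C.
Proof.
have := normr_ge0 u; rewrite /nrm; case: `|u| => x y.
by rewrite lecE /= => /andP [/eqP ->].
Qed.

Lemma nrm_ge0 u : 0 <= nrm u.
Proof. by have := normr_ge0 u; rewrite nrmE ler0c. Qed.

Lemma nrmD u v : nrm (u + v) <= nrm u + nrm v.
Proof. by have := ler_normD u v; rewrite !nrmE -rmorphD /= lecR. Qed.

Lemma nrmN u : nrm (- u) = nrm u.
Proof. by rewrite /nrm normrN. Qed.

Lemma nrmB u v : nrm (u - v) <= nrm u + nrm v.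
Proof. by rewrite (le_trans (nrmD _ _)) // nrmN. Qed.

Lemma nrmBC u v : nrm (u - v) = nrm (v - u).
Proof. by rewrite -nrmN opprB. Qed.

Lemma nrm0 : nrm 0 = 0.
Proof. by rewrite /nrm normr0. Qed.

Lemma nrm_eq0 u : nrm u = 0 -> u = 0.
Proof. by move=> u0; apply/normr0_eq0; rewrite nrmE u0. Qed.

Lemma nrm_sum I (s : seq I) (P : pred I) (f : I -> V) :
  nrm (\sum_(i <- s | P i) f i) <= \sum_(i <- s | P i) nrm (f i).
Proof.
elim/big_ind2 : _ => [|x r y q xr yq|//]; first by rewrite nrm0.
by rewrite (le_trans (nrmD _ _)) // lerD.
Qed.
End RealNorm.

Section ComplexNorm.
Variable R : realType.
Implicit Types z w : R[i].

Lemma nrmM z w : nrm (z * w) = nrm z * nrm w.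
Proof. by apply: (@complexI R); rewrite rmorphM /= -!nrmE normrM. Qed.

Lemma nrmR (x : R) : nrm (x%:C%C) = `|x|.
Proof. by rewrite /nrm normc_def /= expr0n addr0 sqrtr_sqr. Qed.

Lemma Re_le_nrm z : `|complex.Re z| <= nrm z.
Proof.
rewrite /nrm normc_def /= -sqrtr_sqr ler_wsqrtr //.
by rewrite lerDl sqr_ge0.
Qed.

Lemma Im_le_nrm z : `|complex.Im z| <= nrm z.
Proof.
rewrite /nrm normc_def /= -[`|_|]sqrtr_sqr ler_wsqrtr //.
by rewrite lerDr sqr_ge0.
Qed.

Lemma nrm_le_ReIm z : nrm z <= `|complex.Re z| + `|complex.Im z|.
Proof.
rewrite /nrm normc_def /= -(@ler_sqr _ (Num.sqrt _)) ?nnegrE ?sqrtr_ge0 ?addr_ge0 //.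
rewrite sqr_sqrtr ?addr_ge0 ?sqr_ge0 // sqrrD !real_normK ?num_real // addrAC.
by rewrite lerDl mulrn_wge0 // mulr_ge0.
Qed.
End ComplexNorm.

Section Hilbert.
Variables (R : realType) (H : hilbert R).
Implicit Types (u v : H) (k : R[i]) (T : H -> H).

Lemma nrmZ k u : nrm (k *: u) = nrm k * nrm u.
Proof. by apply: (@complexI R); rewrite rmorphM /= -!nrmE normrZ. Qed.

Lemma ipDl u v w : ip (u + v) w = ip u w + ip v w :> R[i].
Proof. exact: linearDl. Qed.
Lemma ipBl u v w : ip (u - v) w = ip u w - ip v w :> R[i].
Proof. exact: linearBl. Qed.
Lemma ipBr u v w : ip w (u - v) = ip w u - ip w v :> R[i].
Proof. exact: raddfB. Qed.
Lemma ipZl k u v : ip (k *: u) v = k * ip u v.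
Proof. exact: linearZl_LR. Qed.
Lemma ipZr k u v : ip u (k *: v) = k^* * ip u v.
Proof. exact: linearZr_LR. Qed.
Lemma ipC u v : ip u v = (ip v u)^* :> R[i].
Proof. by rewrite hermC /= expr0 mul1r. Qed.

Lemma ip_nrm u : ip u u = (nrm u ^+ 2)%:C%C.
Proof. by rewrite ip_norm nrmE rmorphXn. Qed.

Lemma nrmB_sqr u v :
  nrm (u - v) ^+ 2 = nrm u ^+ 2 + nrm v ^+ 2 - 2 * complex.Re (ip u v).
Proof.
have : complex.Re (ip (u - v) (u - v)) =
    complex.Re (ip u u) + complex.Re (ip v v) - 2 * complex.Re (ip u v).
  rewrite ipBl !ipBr (ipC v u); case: (ip u u) (ip v v) (ip u v) => [a b] [c d] [e f].
  by rewrite /=; ring.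
by rewrite !ip_nrm.
Qed.

(** The squared norm of [|v|^2 u - (u, v) v] is [|v|^2] times the difference of the squares of the
    two sides. *)
Lemma CauchySchwarz_nrm u v : nrm (ip u v : R[i]) <= nrm u * nrm v.
Proof.
have [v0|v0] := eqVneq (nrm v) 0.
  have -> : v = 0 by exact: nrm_eq0.
  by rewrite (raddf0 (ip u)) !nrm0 mulr0.
have vgt0 : 0 < nrm v by rewrite lt_neqAle eq_sym v0 nrm_ge0.
rewrite -(@ler_sqr _ (nrm _)) ?nnegrE ?mulr_ge0 ?nrm_ge0 //.
set z : R[i] := ip u v.
have /= := sqr_ge0 (nrm (((nrm v) ^+ 2)%:C%C *: u - z *: v)).
rewrite nrmB_sqr !nrmZ ipZl ipZr -/z.
rewrite nrmR ger0_norm ?sqr_ge0 //.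
have -> : z^* * z = (nrm z ^+ 2)%:C%C by rewrite rmorphXn /= -nrmE normCKC.
rewrite -rmorphM /= => h.
have : 0 <= nrm v ^+ 2 * ((nrm u * nrm v) ^+ 2 - nrm z ^+ 2).
  by apply: le_trans h _; rewrite le_eqVlt; apply/orP; left; apply/eqP; ring.
by rewrite pmulr_rge0 ?exprn_gt0 // subr_ge0.
Qed.

Lemma bounded_op_nrm T : bounded_op T ->
  exists2 B : R, 0 <= B & forall u, nrm (T u) <= B * nrm u.
Proof.
move=> [T_lin T_cont].
pose F : {linear H -> H} := HB.pack T (GRing.isLinear.Build _ _ _ _ T T_lin).
have /linear_boundedP : bounded_near F (nbhs 0).
  by apply/linear_bounded_continuous.
move=> /pinfty_ex_gt0 [M M0 MF]; exists (nrm M); first exact: nrm_ge0.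
move=> u; have := MF u.
by rewrite -{1}(gtr0_norm M0) !nrmE -(rmorphM (real_complex R)) /= lecR.
Qed.

Lemma dense_nrm (D : set H) : dense D ->
  forall u (e : R), 0 < e -> exists2 v, D v & nrm (u - v) < e.
Proof.
move=> Dd u e e0.
have e0c : 0 < e%:C%C by rewrite ltcR.
have [|v [/= vb Dv]] := Dd (ball u e%:C%C)^° _ (@open_interior _ _).
  by exists u; apply: nbhs_singleton; apply: nbhs_interior; exact: nbhsx_ballx.
exists v => //; have := interior_subset vb.
by rewrite -ball_normE /= nrmE ltcR.
Qed.

(** The bound on [D] extends by density, with continuity controlling the error. The lower bound
    serves [coamenable_le], where a constant of unknown sign is replaced by its absolute value. *)
Lemma opnorm_le (D : set H) T (r : R) : dense D -> bounded_op T ->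
  (forall u, D u -> nrm (T u) <= r * nrm u) -> 0 <= r -> 0 <= opnorm T <= r.
Proof.
move=> Dd Tb TD r0; have [B B0 TB] := bounded_op_nrm Tb.
have Tlin := Tb.1.
have T0 : T 0 = 0.
  have := Tlin (-1) 0 0; by rewrite scaler0 addr0 scaleN1r addNr.
have TBB u v : T (u - v) = T u - T v.
  by rewrite addrC -scaleN1r Tlin scaleN1r addrC.
have Tr u : nrm (T u) <= r * nrm u.
  apply/ler_addgt0Pr => e e0.
  (* Replacing [u] by [v] costs at most [(B + r) * nrm (u - v)]; the extra 1 keeps the denominator
     positive. *)
  have d0 : 0 < e / (B + r + 1) by rewrite divr_gt0 // ltr_wpDl // addr_ge0.
  have [v Dv uv] := dense_nrm Dd u d0.
  have -> : T u = T (u - v) + T v by rewrite TBB subrK.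
  rewrite (le_trans (nrmD _ _)) //.
  have h1 := TB (u - v); have h2 := TD v Dv.
  have h3 : nrm v <= nrm u + nrm (u - v).
    by rewrite -{1}(subKr u v) nrmB.
  have h4 : r * nrm v <= r * (nrm u + nrm (u - v)) by rewrite ler_wpM2l.
  have h5 : (B + r + 1) * nrm (u - v) <= e.
    by rewrite -ler_pdivlMl 1?mulrC ?ltW // ltr_wpDl // addr_ge0.
  have h6 := nrm_ge0 (u - v).
  lra.
rewrite /opnorm; apply/andP; split.
  apply: sup_upper_bound.
    split; first by exists (nrm (T 0)), 0; rewrite //= normr0 ler01.
    exists r => _ [u /= u1 <-]; apply: le_trans (Tr u) _; rewrite ler_piMr //.
    by rewrite -lecR -nrmE.
  by exists 0 => /=; rewrite ?normr0 ?ler01 // T0 normr0.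
apply: ge_sup; first by exists (nrm (T 0)), 0; rewrite //= normr0 ler01.
move=> _ [u /= u1 <-]; apply: le_trans (Tr u) _; rewrite ler_piMr //.
by rewrite -lecR -nrmE.
Qed.
End Hilbert.

(** * Almost invariant vectors *)

Section ApproximateCharacter.
Variables (R : realType) (A : starAlgType R[i]) (phi eps : {scalar A}).
Variables (H : hilbert R) (Lambda : {linear A -> H}) (rep : A -> H -> H).
Hypothesis Lambda_GNS : GNS_pair phi Lambda.
Hypothesis rep_GNS : GNS_representation Lambda rep.
Hypothesis epsM : forall a b, eps (a ** b) = eps a * eps b.
Hypothesis eps_star : forall a, eps (star a) = (eps a)^*.
Hypothesis eps1 : exists a, eps a = 1.
Implicit Types (a b c : A) (F : seq A).

Lemma GNS_mul_bounded a : exists2 B : R, 0 <= B &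
  forall b, nrm (Lambda (a ** b)) <= B * nrm (Lambda b).
Proof.
have [B B0 aB] := bounded_op_nrm (rep_bounded rep_GNS a); exists B => // b.
by rewrite -(rep_Lambda rep_GNS).
Qed.

Lemma GNS_adjoint c a b :
  ip (Lambda (star c ** a)) (Lambda b) = ip (Lambda a) (Lambda (c ** b)) :> R[i].
Proof. by rewrite !(GNS_ip Lambda_GNS) starM amulA. Qed.

(** Eliminates the operator norm: it is bounded by any constant that works on the dense range of
    [Lambda]. *)
Lemma coamenable_le : coamenable eps rep -> exists2 M : R, 0 <= M &
  forall a (r : R), 0 <= r ->
    (forall b, nrm (Lambda (a ** b)) <= r * nrm (Lambda b)) ->
    nrm (eps a) <= M * r.
Proof.
move=> [M epsM']; exists `|M| => // a r r0 ar.
have /andP [n0 n_le] : 0 <= opnorm (rep a) <= r.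
  apply: (opnorm_le (GNS_dense Lambda_GNS) (rep_bounded rep_GNS a)) => //.
  by move=> _ [b _ <-]; rewrite (rep_Lambda rep_GNS).
have := epsM' a; rewrite nrmE lecR => /le_trans; apply.
rewrite (le_trans (ler_norm _)) // normrM (ger0_norm n0).
exact: ler_wpM2l.
Qed.

(** The multiplier [c - eps c 1] applied to [a]; as [A] may have no unit, it is encoded as a map on
    [A]. *)
Definition deviation c a : A := c ** a - eps c *: a.

Lemma deviation_linear c : linear (deviation c).
Proof.
move=> k a b; rewrite /deviation amulDr amulZr scalerDr opprD scalerBr.
by rewrite addrACA !scalerA [k * _]mulrC.
Qed.

Lemma deviationM c a b : deviation c (a ** b) = deviation c a ** b.
Proof. by rewrite /deviation amulDl amulNl amulZl amulA. Qed.

Lemma eps_deviation c a : eps (deviation c a) = 0.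
Proof. by rewrite /deviation linearB linearZ /= epsM subrr. Qed.

Lemma deviation_bounded c : exists2 B : R, 0 <= B &
  forall a, nrm (Lambda (deviation c a)) <= B * nrm (Lambda a).
Proof.
have [B B0 cB] := GNS_mul_bounded c; exists (B + nrm (eps c)).
  by rewrite addr_ge0 // nrm_ge0.
move=> a; rewrite /deviation linearB linearZ /= (le_trans (nrmB _ _)) //.
by rewrite mulrDl nrmZ lerD.
Qed.

Lemma deviation_adjoint c a b :
  ip (Lambda (deviation (star c) a)) (Lambda b) =
  ip (Lambda a) (Lambda (deviation c b)) :> R[i].
Proof.
have LE c' a' : Lambda (deviation c' a') = Lambda (c' ** a') - eps c' *: Lambda a'.
  by rewrite /deviation linearB linearZ.
by rewrite !LE ipBl ipBr ipZl ipZr GNS_adjoint eps_star.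
Qed.

(* Without such an [a], [\sum_(c <- F) (c - eps c)^* (c - eps c)] would be
   bounded below; subtracting a small multiple of it from the identity then gives
   a strict contraction with [eps]-value 1, and its powers contradict the
   boundedness of [eps]. *)
Lemma approximate_vector F (d : R) : coamenable eps rep -> 0 < d ->
  exists a, nrm (Lambda a) = 1 /\
    forall c, c \in F -> nrm (Lambda (deviation c a)) < d.
Proof.
move=> /coamenable_le [M M0 epsB] d0; apply: contrapT => none.
pose g a := \sum_(c <- F) deviation (star c) (deviation c a).
have gM a b : g (a ** b) = g a ** b.
  rewrite /g; elim: (F) => [|c F' IH]; first by rewrite !big_nil a0mul.
  by rewrite !big_cons IH !deviationM amulDl.
have epsg a : eps (g a) = 0.
  rewrite /g linear_sum big1 // => c _; exact: eps_deviation.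
have [B B0 gB] : exists2 B : R, 0 <= B &
    forall a, nrm (Lambda (g a)) <= B * nrm (Lambda a).
  rewrite /g; elim: (F) => [|c F' [B B0 IH]].
    by exists 0 => // a; rewrite big_nil linear0 nrm0 mul0r.
  have [B1 B10 cB1] := deviation_bounded c.
  have [B2 B20 cB2] := deviation_bounded (star c).
  exists (B2 * B1 + B) => [|a]; first by rewrite addr_ge0 ?mulr_ge0.
  rewrite big_cons linearD (le_trans (nrmD _ _)) // mulrDl lerD //.
  by rewrite (le_trans (cB2 _)) // -mulrA ler_wpM2l.
have gE a : complex.Re (ip (Lambda (g a)) (Lambda a)) =
    \sum_(c <- F) nrm (Lambda (deviation c a)) ^+ 2.
  rewrite /g; elim: (F) => [|c F' IH].
    by rewrite !big_nil linear0 linear0l.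
  rewrite !big_cons linearD ipDl raddfD /= IH; congr (_ + _).
  by rewrite deviation_adjoint ip_nrm.
(* Rescaled to norm 1, [Lambda a] is moved by at least [d] by some [c] in [F]; that single term
   already gives the lower bound. *)
have glow a : d ^+ 2 * nrm (Lambda a) ^+ 2 <=
    complex.Re (ip (Lambda (g a)) (Lambda a)).
  rewrite gE; have [->|a0] := eqVneq (nrm (Lambda a)) 0.
    by rewrite expr0n mulr0 sumr_ge0 // => c _; exact: sqr_ge0.
  have agt0 : 0 < nrm (Lambda a) by rewrite lt_neqAle eq_sym a0 nrm_ge0.
  pose k : R[i] := ((nrm (Lambda a))^-1)%:C%C.
  have kE : nrm k = (nrm (Lambda a))^-1 by rewrite nrmR ger0_norm // invr_ge0 ltW.
  have [c cF cd] : exists2 c, c \in F & d <= nrm (Lambda (deviation c (k *: a))).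
    apply: contrapT => far; apply: none; exists (k *: a).
    split; first by rewrite linearZ /= nrmZ kE mulVf.
    by move=> c cF; rewrite ltNge; apply/negP => cd; apply: far; exists c.
  move: cd; rewrite -[k *: a]addr0 deviation_linear.
  have -> : deviation c 0 = 0 by rewrite /deviation amul0 scaler0 subr0.
  rewrite addr0 linearZ /= nrmZ kE ler_pdivlMl // => cd.
  rewrite (big_rem c) //= -exprMn ler_wpDr //.
    by rewrite sumr_ge0 // => ? _; exact: sqr_ge0.
  by rewrite ler_sqr ?nnegrE ?nrm_ge0 ?mulr_ge0 ?(ltW d0) ?(ltW agt0) // mulrC.
(* [D] bounds [g], and the summand [d ^+ 2] ensures [0 < D] and [d ^+ 2 / D <= 1]. The squared norm
   of [1 - s g] is at most [1 - 2 s d^2 + s^2 D^2]; the chosen [s] minimises this, with minimum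
   [q]. *)
pose D := B + d ^+ 2.
have D0 : 0 < D by rewrite ltr_wpDl // exprn_gt0.
pose s := d ^+ 2 / D ^+ 2.
pose q := 1 - (d ^+ 2 / D) ^+ 2.
have q01 : 0 <= q < 1.
  rewrite subr_ge0 ltrBlDr ltrDl exprn_gt0 ?divr_gt0 ?exprn_gt0 // andbT.
  by rewrite expr_le1 ?divr_ge0 ?sqr_ge0 ?(ltW D0) // ler_pdivrMr // mul1r lerDr.
pose h a := a - s%:C%C *: g a.
have hM a b : h (a ** b) = h a ** b by rewrite /h gM amulDl amulNl amulZl.
have epsh a : eps (h a) = eps a by rewrite /h linearB linearZ /= epsg mulr0 subr0.
have s0 : 0 <= s by rewrite divr_ge0 ?sqr_ge0.
have hq a : nrm (Lambda (h a)) <= Num.sqrt q * nrm (Lambda a).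
  rewrite -ler_sqr ?nnegrE ?mulr_ge0 ?sqrtr_ge0 ?nrm_ge0 //.
  rewrite exprMn sqr_sqrtr; last by case/andP: q01.
  rewrite /h linearB linearZ /= nrmBC nrmB_sqr nrmZ nrmR ger0_norm // ipZl.
  have -> : complex.Re (s%:C%C * ip (Lambda (g a)) (Lambda a)) =
      s * complex.Re (ip (Lambda (g a)) (Lambda a)).
    by case: (ip _ _) => x y /=; rewrite mul0r subr0.
  have h1 : 2 * (s * (d ^+ 2 * nrm (Lambda a) ^+ 2)) <=
      2 * (s * complex.Re (ip (Lambda (g a)) (Lambda a))).
    by rewrite ler_wpM2l // ler_wpM2l.
  have h2 : (s * nrm (Lambda (g a))) ^+ 2 <= (s * (D * nrm (Lambda a))) ^+ 2.
    have Da0 : 0 <= D * nrm (Lambda a) by rewrite mulr_ge0 ?nrm_ge0 ?(ltW D0).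
    apply: lerXn2r; rewrite ?nnegrE; [exact: mulr_ge0 (nrm_ge0 _)|exact: mulr_ge0|].
    rewrite ler_wpM2l // (le_trans (gB a)) // ler_wpM2r ?nrm_ge0 //.
    by rewrite lerDl sqr_ge0.
  have -> : q * nrm (Lambda a) ^+ 2 = (s * (D * nrm (Lambda a))) ^+ 2
      + nrm (Lambda a) ^+ 2 - 2 * (s * (d ^+ 2 * nrm (Lambda a) ^+ 2)).
    by rewrite /q /s; field; rewrite gt_eqF.
  lra.
(* [a1] replaces the missing unit: [iter n h a1] keeps [eps]-value 1, while left multiplication by
   it has norm at most [Num.sqrt q ^+ n * B1]. *)
have [a1 a11] := eps1.
have [B1 B10 a1B] := GNS_mul_bounded a1.
have hn n : 1 <= M * (Num.sqrt q ^+ n * B1).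
  have -> : 1 = nrm (eps (iter n h a1)).
    have -> : eps (iter n h a1) = 1 by elim: n => //= n <-.
    by rewrite /nrm normr1.
  apply: epsB => [|b]; first by rewrite mulr_ge0 ?exprn_ge0 ?sqrtr_ge0.
  have -> : iter n h a1 ** b = iter n h (a1 ** b) by elim: n => //= n <-; rewrite hM.
  rewrite -mulrA; apply: (@le_trans _ _ (Num.sqrt q ^+ n * nrm (Lambda (a1 ** b)))).
    elim: n => [|n IH] /=; first by rewrite mul1r.
    by rewrite (le_trans (hq _)) // exprS -mulrA ler_wpM2l ?sqrtr_ge0.
  by rewrite ler_wpM2l ?exprn_ge0 ?sqrtr_ge0.
have q1 : `|Num.sqrt q| < 1.
  rewrite ger0_norm ?sqrtr_ge0 // -sqrtr1 ltr_sqrt //.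
  by case/andP: q01.
have lim0 : (fun n => M * (Num.sqrt q ^+ n * B1)) @ \oo --> (0 : R).
  rewrite -(mulr0 M) -(mul0r B1); apply: cvgMr; apply: cvgMl.
  exact: cvg_expr.
have := @cvgr_lt _ _ _ _ _ _ lim0 1 ltr01.
move=> [n _ /(_ n (leqnn n)) /=]; rewrite ltNge => /negP; apply.
exact: hn.
Qed.
End ApproximateCharacter.

(** * Limits of bounded functions along an ultrafilter *)

Section UltraLimits.
Variables (R : realType) (T : Type) (U : set_system T).
Implicit Types (f g : T -> R[i]) (z w : R[i]).

Definition ulim f z : Prop :=
  forall e : R, 0 < e -> \forall a \near U, nrm (f a - z) < e.

Lemma ulim_unique f z w : ProperFilter U -> ulim f z -> ulim f w -> z = w.
Proof.
move=> FU fz fw; apply: contrapT => zw.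
have zw0 : 0 < nrm (z - w).
  rewrite lt_neqAle nrm_ge0 andbT eq_sym; apply/eqP => /nrm_eq0 /eqP.
  by rewrite subr_eq0 => /eqP.
have e0 : 0 < nrm (z - w) / 2 by rewrite divr_gt0.
have [a [az aw]] := filter_ex (filterI (fz _ e0) (fw _ e0)).
have : nrm (z - w) <= nrm (f a - w) + nrm (f a - z).
  by rewrite -[X in nrm X](_ : f a - w - (f a - z) = z - w) ?nrmB //; ring.
rewrite /= in az aw *; lra.
Qed.

Lemma ulim_linear k f g z w : Filter U -> ulim f z -> ulim g w ->
  ulim (fun a => k * f a + g a) (k * z + w).
Proof.
move=> FU fz gw e e0.
have k1 : 0 < nrm k + 1 by rewrite ltr_wpDl // nrm_ge0.
have d0 : 0 < e / (nrm k + 1) / 2 by rewrite !divr_gt0.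
have e2 : 0 < e / 2 by rewrite divr_gt0.
apply: filterS2 (fz _ d0) (gw _ e2) => a az aw.
have -> : k * f a + g a - (k * z + w) = k * (f a - z) + (g a - w) by ring.
rewrite (le_lt_trans (nrmD _ _)) // nrmM (splitr e) ler_ltD //.
have : (nrm k + 1) * nrm (f a - z) <= e / 2.
  by rewrite -ler_pdivlMl // mulrC ltW // mulrAC.
have := nrm_ge0 (f a - z); lra.
Qed.

Lemma ulim_ge0 f z : ProperFilter U -> (forall a, 0 <= f a) -> ulim f z -> 0 <= z.
Proof.
move=> FU f0 fz.
have fIm a : complex.Im (f a) = 0.
  by have := f0 a; rewrite lecE /= => /andP [/eqP].
have fRe a : 0 <= complex.Re (f a).
  by have := f0 a; rewrite lecE /= => /andP [_].
rewrite lecE /=; apply/andP; split.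
  apply/eqP; apply/eqP; rewrite -normr_le0; apply/ler_addgt0Pr => e e0.
  have [a /= az] := filter_ex (fz e e0); rewrite add0r ltW //.
  apply: le_lt_trans az; apply: le_trans (Im_le_nrm _).
  by rewrite raddfB /= fIm sub0r normrN.
apply/ler_addgt0Pr => e e0.
have [a /= az] := filter_ex (fz e e0).
have := le_lt_trans (Re_le_nrm _) az.
rewrite raddfB /= ltr_norml => /andP [_]; have := fRe a; lra.
Qed.

(** Compactness of [[- B, B]] gives a cluster point of the image filter, and a cluster point of an
    ultrafilter is a limit. *)
Lemma ultra_real_lim (f : T -> R) (B : R) : UltraFilter U ->
  (\forall a \near U, `|f a| <= B) ->
  exists l, forall e, 0 < e -> \forall a \near U, `|f a - l| < e.
Proof.
move=> UU fB.
have [|l [_ lcl]] := @segment_compact R (- B) B (f @ U) _.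
  by apply: filterS fB => a /=; rewrite in_itv /= ler_norml.
exists l => e e0.
have [//|far] := in_ultra_setVsetC [set a | `|f a - l| < e] UU.
have [x [/= xfar]] := lcl (~` [set x | `|x - l| < e]) (ball l e) far (nbhsx_ballx _ _ e0).
by rewrite -ball_normE /= distrC.
Qed.

Lemma ultra_lim f (B : R) : UltraFilter U ->
  (\forall a \near U, nrm (f a) <= B) -> exists z, ulim f z.
Proof.
move=> UU fB.
have [x fx] : exists l, forall e, 0 < e -> \forall a \near U, `|complex.Re (f a) - l| < e.
  apply: (@ultra_real_lim _ B) => //; apply: filterS fB => a.
  exact: le_trans (Re_le_nrm _).
have [y fy] : exists l, forall e, 0 < e -> \forall a \near U, `|complex.Im (f a) - l| < e.
  apply: (@ultra_real_lim _ B) => //; apply: filterS fB => a.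
  exact: le_trans (Im_le_nrm _).
exists (x +i* y)%C => e e0; have e2 : 0 < e / 2 by rewrite divr_gt0.
apply: filterS2 (fx _ e2) (fy _ e2) => a ax ay.
rewrite (le_lt_trans (nrm_le_ReIm _)) // !raddfB /= (splitr e).
exact: ltrD.
Qed.

Lemma ulim_near_cst f z : Filter U -> (\forall a \near U, f a = z) -> ulim f z.
Proof.
by move=> FU fz e e0; apply: filterS fz => a ->; rewrite subrr nrm0.
Qed.
End UltraLimits.

Section ApproximateUltrafilter.
Variables (R : realType) (A : starAlgType R[i]) (phi eps : {scalar A}).
Variables (H : hilbert R) (Lambda : {linear A -> H}) (rep : A -> H -> H).
Hypothesis Lambda_GNS : GNS_pair phi Lambda.
Hypothesis rep_GNS : GNS_representation Lambda rep.
Hypothesis epsM : forall a b, eps (a ** b) = eps a * eps b.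
Hypothesis eps_star : forall a, eps (star a) = (eps a)^*.
Hypothesis eps1 : exists a, eps a = 1.

(** The sets [B F d] are non-empty by [approximate_vector] and shrink as [F] grows and [d]
    decreases, so they generate a proper filter. Refining it to an ultrafilter makes all bounded
    functions converge. *)
Lemma approximate_ultrafilter : coamenable eps rep ->
  exists U : set_system A, [/\ UltraFilter U,
    \forall a \near U, nrm (Lambda a) = 1 &
    forall c (d : R), 0 < d -> \forall a \near U, nrm (Lambda (deviation eps c a)) < d].
Proof.
move=> coam.
pose B (F : seq A) (d : R) := [set a | nrm (Lambda a) = 1 /\
  forall c, c \in F -> nrm (Lambda (deviation eps c a)) < d].
pose G := [set P : set A | exists F d, 0 < d /\ B F d `<=` P].
have GP : ProperFilter G.
  apply: Build_ProperFilter_ex => [P [F [d [d0 BP]]]|].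
    have [a aB] := approximate_vector Lambda_GNS rep_GNS epsM eps_star eps1 F coam d0.
    by exists a; exact: BP.
  split.
  - by exists [::], 1; split; [exact: ltr01|].
  - move=> P Q [F [d [d0 BP]]] [F' [d' [d0' BQ]]].
    exists (F ++ F'), (Num.min d d'); split; first by rewrite lt_min d0.
    move=> a [a1 aF]; split.
      apply: BP; split => // c cF.
      by have := aF c; rewrite mem_cat cF lt_min => /(_ isT) /andP [].
    apply: BQ; split => // c cF.
    by have := aF c; rewrite mem_cat cF orbT lt_min => /(_ isT) /andP [].
  - move=> P Q PQ [F [d [d0 BP]]]; exists F, d; split => //.
    exact: subset_trans PQ.
have [U [UU GU]] := ultraFilterLemma GP; exists U; split => //.
  by apply: GU; exists [::], 1; split; [exact: ltr01|move=> a []].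
move=> c d d0; apply: GU; exists [:: c], d; split => // a [_].
by apply; rewrite inE.
Qed.
End ApproximateUltrafilter.

(** * The invariant mean *)

Section SeriesEstimates.
Variable R : realType.

Lemma series_cvg_nrm (u : nat -> R[i]) (l : R[i]) :
  series (u : nat -> R[i]^o) @ \oo --> (l : R[i]^o) ->
  forall e : R, 0 < e -> exists N, forall n, (N <= n)%N ->
    nrm (\sum_(0 <= i < n) u i - l) < e.
Proof.
move=> ul e e0; have e0c : 0 < e%:C%C :> R[i] by rewrite ltcR.
have [N _ NP] := @cvgr_distC_lt _ _ _ _ _ _ _ ul _ e0c.
by exists N => n /NP; rewrite /series /= nrmE ltcR.
Qed.

(** A tail is the difference of two partial sums, both close to the limit. *)
Lemma square_summable_tail (H : hilbert R) (xi : nat -> H) :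
  square_summable xi -> forall e : R, 0 < e -> exists N, forall k, (N <= k)%N ->
    forall n, (k <= n)%N -> \sum_(k <= i < n) nrm (xi i) ^+ 2 <= e.
Proof.
move=> /cvg_ex [l xil] e e0; have e2 : 0 < e / 2 by rewrite divr_gt0.
have [N NP] := series_cvg_nrm xil e2; exists N => k Nk n kn.
have h1 := NP _ Nk; have h2 := NP _ (leq_trans Nk kn).
apply: le_trans (ler_norm _) _; rewrite -nrmR.
have -> : (\sum_(k <= i < n) nrm (xi i) ^+ 2)%:C%C =
    (\sum_(0 <= i < n) `|xi i| ^+ 2 - l) - (\sum_(0 <= i < k) `|xi i| ^+ 2 - l).
  rewrite opprB addrA subrK (big_cat_nat (leq0n k) kn) /= addrAC subrr add0r.
  by rewrite rmorph_sum; apply: eq_bigr => i _; rewrite rmorphXn nrmE.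
by apply: le_trans (nrmB _ _) _; rewrite (splitr e) lerD // ltW.
Qed.
End SeriesEstimates.

Section Coamenability.
Variables (R : realType) (A : starAlgType R[i]).
Variables (Delta : A -> multiplier (tensor A A)) (phi eps : {scalar A}).
Hypothesis Delta_mH : multiplier_Hopf Delta.
Hypothesis eps_counit : counit Delta eps.
Variables (H : hilbert R) (Lambda : {linear A -> H}).
Hypothesis Lambda_GNS : GNS_pair phi Lambda.
Variables (K : hilbert R) (t : H -> H -> K) (W Wadj : K -> K).
Hypothesis t_tensor : hilbert_tensor t.
Hypothesis W_mu : multiplicative_unitary Delta Lambda t W Wadj.
Variable U : set_system A.
Hypothesis U_ultra : UltraFilter U.
Hypothesis U_unit : \forall a \near U, nrm (Lambda a) = 1.
Hypothesis U_eps : forall c (d : R), 0 < d ->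
  \forall a \near U, nrm (Lambda (deviation eps c a)) < d.
Implicit Types (a b c : A) (u v xi eta : H) (p q : K) (x T : H -> H).

Lemma Wadj_ip p q : ip (W p) q = ip p (Wadj q) :> R[i].
Proof. by have [_ adj _ _] := mu_unitary W_mu; exact: adj. Qed.

Lemma Wadj_nrm p : nrm (Wadj p) = nrm p.
Proof.
have [_ _ _ WK] := mu_unitary W_mu.
have := Wadj_ip (Wadj p) p; rewrite WK !ip_nrm => /(@complexI R) /eqP.
by rewrite eqrXn2 ?nrm_ge0 // => /eqP.
Qed.

Lemma WadjB p q : Wadj (p - q) = Wadj p - Wadj q.
Proof.
have [W_lin _ KW WK] := mu_unitary W_mu.
apply: (can_inj KW); rewrite WK [Wadj p - _]addrC -[- Wadj q]scaleN1r.
by rewrite W_lin !WK scaleN1r addrC.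
Qed.

Lemma tB u xi eta : t u (xi - eta) = t u xi - t u eta.
Proof.
rewrite [xi - eta]addrC -scaleN1r; have /= -> := (ht_bilinear t_tensor).2 u (-1) eta xi.
by rewrite scaleN1r addrC.
Qed.

Lemma t_nrm u v : nrm (t u v) = nrm u * nrm v.
Proof.
have := ht_ip t_tensor u v u v; rewrite !ip_nrm -rmorphM => /(@complexI R) /eqP.
by rewrite -exprMn eqrXn2 ?mulr_ge0 ?nrm_ge0 // => /eqP.
Qed.

(** By [muE], [Wadj] sends [t (Lambda a) (Lambda b)] to the image of [Delta b (a \ox 1)], so the
    coefficient is the one computed in [comult_slice]. *)
Lemma Wadj_Lambda b c : exists e : A, eps e = phi (star c ** b) /\
  forall a d, ip (Wadj (t (Lambda a) (Lambda b))) (t (Lambda d) (Lambda c)) =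
    ip (Lambda (e ** a)) (Lambda d) :> R[i].
Proof.
have [e [epse eP]] := comult_slice Delta_mH phi eps_counit b c.
exists e; split => // a d.
have [F [_ FE]] := mH_bij_l Delta_mH.
have [_ _ KW _] := mu_unitary W_mu.
rewrite -(muE W_mu (FE b a)) KW (GNS_ip Lambda_GNS) -(eP _ _ _ (FE b a)).
have bil1 : bilinear_for *:%R *:%R (fun c d => t (Lambda c) (Lambda d)).
  split=> [y|y] k z z' /=; rewrite linearP.
    exact: (ht_bilinear t_tensor).1.
  exact: (ht_bilinear t_tensor).2.
have bil2 : bilinear_for *:%R *:%R
    (fun u v : A => phi (star d ** u) * phi (star c ** v) : R[i]^o).
  split=> [y|y] k z z' /=; rewrite amulDr amulZr linearP /=.
    by rewrite mulrDl -mulrA.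
  by rewrite mulrDr mulrCA.
elim/tens_ind: (F _) => [|s s' IHs IHs'|u' v'].
- by rewrite !tlift0 // linear0l.
- by rewrite !tliftD // ipDl IHs IHs'.
- by rewrite !tlift_tens // (ht_ip t_tensor) !(GNS_ip Lambda_GNS).
Qed.

Definition defect a xi : R := nrm (Wadj (t (Lambda a) xi) - t (Lambda a) xi).

Lemma defect_le a xi : nrm (Lambda a) = 1 -> defect a xi <= 2 * nrm xi.
Proof.
move=> a1; rewrite /defect (le_trans (nrmB _ _)) // Wadj_nrm t_nrm a1 mul1r.
by rewrite mulr2n mulrDl !mul1r.
Qed.

Lemma defect_cvg xi (e : R) : 0 < e -> \forall a \near U, defect a xi < e.
Proof.
move=> e0; have e4 : 0 < e / 4 by rewrite divr_gt0.
have [_ [b _ <-] xib] := dense_nrm (GNS_dense Lambda_GNS) xi e4.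
have [e' [epse' e'P]] := Wadj_Lambda b b.
(* Since [Wadj] is isometric and [eps e'] is the squared norm of [Lambda b], the squared defect at
   [Lambda b] is at most twice the norm of the deviation of [e']. Passing from [Lambda b] to [xi]
   costs less than [e / 2]. *)
have d0 : 0 < (e / 4) ^+ 2 / 2 by rewrite divr_gt0 // exprn_gt0.
apply: filterS2 U_unit (U_eps e' d0) => a a1 ad.
have near_b : defect a (Lambda b) < e / 4.
  rewrite -ltr_sqr ?nnegrE ?nrm_ge0 ?(ltW e4) //.
  rewrite /defect nrmB_sqr Wadj_nrm t_nrm a1 mul1r e'P.
  have -> : Lambda (e' ** a) = Lambda (deviation eps e' a) + eps e' *: Lambda a.
    by rewrite /deviation linearB linearZ /= subrK.
  rewrite ipDl ipZl ip_nrm a1 expr1n mulr1 epse' -(GNS_ip Lambda_GNS) ip_nrm.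
  rewrite raddfD /=.
  have := le_trans (Re_le_nrm _) (CauchySchwarz_nrm (Lambda (deviation eps e' a)) (Lambda a)).
  rewrite a1 mulr1 ler_norml => /andP [lo _].
  rewrite -/(complex.Re _); lra.
have -> : defect a xi = nrm (Wadj (t (Lambda a) (xi - Lambda b)) - t (Lambda a) (xi - Lambda b)
    + (Wadj (t (Lambda a) (Lambda b)) - t (Lambda a) (Lambda b))).
  by rewrite tB WadjB addrACA subrK -opprD subrK.
have far := defect_le (xi - Lambda b) a1.
rewrite (le_lt_trans (nrmD _ _)) //.
rewrite /defect in near_b far; lra.
Qed.

Section Invariance.
Variables (x : H -> H) (x1 : K -> K).
Hypothesis x_amp : ampliation t x x1.

(** The error made by dropping [W] from one matrix coefficient of [W (x \ox 1) W^*]; without [W] the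
    coefficient factorises. *)
Definition slice_term a xi eta : R[i] :=
  ip ((W \o x1 \o Wadj) (t (Lambda a) xi)) (t (Lambda a) eta) -
  ip (x (Lambda a)) (Lambda a) * ip xi eta.

(** With [p] and [q] the two tensors, the error splits as [(x1 (Wadj p - p), Wadj q) + (x1 p, Wadj q
    - q)]. *)
Lemma slice_term_le : exists2 B : R, 0 < B & forall a xi eta, nrm (Lambda a) = 1 ->
  nrm (slice_term a xi eta) <= B * (defect a xi * nrm eta + nrm xi * defect a eta).
Proof.
have [x1_bd x1E] := x_amp; have [B B0 x1B] := bounded_op_nrm x1_bd.
have x1_lin := x1_bd.1; exists (B + 1); first by rewrite ltr_wpDl.
move=> a xi eta a1; rewrite /slice_term /= Wadj_ip.
rewrite -(ht_ip t_tensor) -x1E.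
set p := t _ xi; set q := t _ eta.
have -> : ip (x1 (Wadj p)) (Wadj q) - ip (x1 p) q =
    ip (x1 (Wadj p - p)) (Wadj q) + ip (x1 p) (Wadj q - q) :> R[i].
  have -> : x1 (Wadj p - p) = x1 (Wadj p) - x1 p.
    by rewrite addrC -scaleN1r x1_lin scaleN1r addrC.
  by rewrite ipBl ipBr addrA subrK.
rewrite (le_trans (nrmD _ _)) //.
have pE : nrm p = nrm xi by rewrite t_nrm a1 mul1r.
have qE : nrm (Wadj q) = nrm eta by rewrite Wadj_nrm t_nrm a1 mul1r.
have h1 := CauchySchwarz_nrm (x1 (Wadj p - p)) (Wadj q).
have h2 := CauchySchwarz_nrm (x1 p) (Wadj q - q).
rewrite (le_trans (lerD h1 h2)) // mulrDr qE lerD // mulrA ler_wpM2r ?nrm_ge0 //.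
  by rewrite (le_trans (x1B _)) // ler_wpM2r ?nrm_ge0 // lerDl.
by rewrite (le_trans (x1B _)) // pE ler_wpM2r ?nrm_ge0 // lerDl.
Qed.

Lemma slice_term_cvg xi eta (e : R) : 0 < e ->
  \forall a \near U, nrm (slice_term a xi eta) < e.
Proof.
move=> e0; have [B B0 BP] := slice_term_le.
pose D := B * (nrm eta + nrm xi) + 1.
have D0 : 0 < D by rewrite ltr_wpDl // mulr_ge0 ?(ltW B0) // addr_ge0 ?nrm_ge0.
have d0 : 0 < e / D by rewrite divr_gt0.
apply: filterS3 U_unit (defect_cvg xi d0) (defect_cvg eta d0) => a a1 axi aeta.
apply: (le_lt_trans (BP _ _ _ a1)).
apply: (@le_lt_trans _ _ (B * (e / D * nrm eta + nrm xi * (e / D)))).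
  rewrite ler_wpM2l ?(ltW B0) // lerD //.
    by rewrite ler_wpM2r ?nrm_ge0 ?(ltW axi).
  by rewrite ler_wpM2l ?nrm_ge0 ?(ltW aeta).
have -> : B * (e / D * nrm eta + nrm xi * (e / D)) = (D - 1) * (e / D).
  by rewrite /D; ring.
by rewrite mulrBl mul1r mulrC divfK ?gt_eqF // gtrDl oppr_lt0.
Qed.

(** Limit and series may be interchanged: finitely many errors vanish along [U], and the remaining
    ones are bounded uniformly in [a] by square summability. *)
Lemma slice_mean (y : H -> H) (w : R[i]) (xi eta : nat -> H) :
  square_summable xi -> square_summable eta ->
  series (fun n => ip (xi n) (eta n) : R[i]^o) @ \oo --> (w : R[i]^o) ->
  (forall u v, series (fun n =>
      ip ((W \o x1 \o Wadj) (t u (xi n))) (t v (eta n)) : R[i]^o) @ \oo -->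
    (ip (y u) v : R[i]^o)) ->
  ulim U (fun a => ip (y (Lambda a)) (Lambda a) - ip (x (Lambda a)) (Lambda a) * w) 0.
Proof.
move=> xi_sum eta_sum w_lim y_lim e e0.
have [B B0 BP] := slice_term_le.
(* The head of the error series takes one share, its tail two, and the truncations of the two given
   series one each. A tail term is at most [2 * B] times the sum of the two squared norms, whence
   [d / (2 * B)] below. *)
pose d := e / 5.
have d0 : 0 < d by rewrite divr_gt0.
have dB0 : 0 < d / (2 * B) by rewrite divr_gt0 ?mulr_gt0.
have [N1 N1P] := square_summable_tail xi_sum dB0.
have [N2 N2P] := square_summable_tail eta_sum dB0.
pose N := maxn N1 N2.
have head : \forall a \near U,
    \sum_(0 <= n < N) nrm (slice_term a (xi n) (eta n)) < d.
  (* [N.+1] in place of [N] covers [N = 0] and makes the bound on the head strict. *)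
  have dN : 0 < d / (N.+1)%:R by rewrite divr_gt0 ?ltr0n.
  suff : \forall a \near U, forall n, (n < N)%N ->
      nrm (slice_term a (xi n) (eta n)) < d / (N.+1)%:R.
    apply: filterS => a aN; apply: (@le_lt_trans _ _ (\sum_(0 <= n < N) d / (N.+1)%:R)).
      by rewrite !big_mkord ler_sum // => i _; rewrite ltW // aN.
    rewrite sumr_const_nat subn0 -[X in X < _]mulr_natr mulrAC.
    by rewrite ltr_pdivrMr ?ltr0n // ltr_pM2l // ltr_nat.
  move: (d / _) dN => r r0; elim: (N) => [|n IH]; first exact: filterE.
  apply: filterS2 IH (slice_term_cvg (xi n) (eta n) r0) => a IH an k.
  by rewrite ltnS leq_eqVlt => /orP [/eqP ->|/IH].
apply: filterS2 U_unit head => a a1 ahead; rewrite subr0.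
set l1 := ip (y _) _; set z := ip (x _) _.
have z1 : 0 < nrm z + 1 by rewrite ltr_wpDl ?nrm_ge0.
have dz : 0 < d / (nrm z + 1) by rewrite divr_gt0.
have [k1 k1P] := series_cvg_nrm (y_lim (Lambda a) (Lambda a)) d0.
have [k2 k2P] := series_cvg_nrm w_lim dz.
(* The truncation [k] may depend on [a], since [N] was fixed before [a]. *)
pose k := maxn N (maxn k1 k2).
have Nk : (N <= k)%N by exact: leq_maxl.
have h1 : nrm (\sum_(0 <= n < k)
    ip ((W \o x1 \o Wadj) (t (Lambda a) (xi n))) (t (Lambda a) (eta n)) - l1) < d.
  by apply: k1P; rewrite /k leq_max leq_maxl orbT.
have h2 : nrm (\sum_(0 <= n < k) ip (xi n) (eta n) - w) < d / (nrm z + 1).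
  by apply: k2P; rewrite /k leq_max leq_maxr orbT.
set S1 := \sum_(0 <= n < k) _ in h1; set S2 := \sum_(0 <= n < k) _ in h2.
have SE : S1 - z * S2 = \sum_(0 <= n < k) slice_term a (xi n) (eta n).
  by rewrite /S1 /S2 mulr_sumr -sumrB.
have tail : nrm (S1 - z * S2) < 3 * d.
  rewrite SE (le_lt_trans (nrm_sum _ _ _)) // (big_cat_nat (leq0n N) Nk) /=.
  have : \sum_(N <= n < k) nrm (slice_term a (xi n) (eta n)) <=
      \sum_(N <= n < k) (2 * B) * (nrm (xi n) ^+ 2 + nrm (eta n) ^+ 2).
    apply: ler_sum => n _; apply: le_trans (BP _ _ _ a1) _.
    rewrite -mulrA [2 * _]mulrC -mulrA ler_pM2l //.
    have g1 := defect_le (xi n) a1; have g2 := defect_le (eta n) a1.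
    have g3 : defect a (xi n) * nrm (eta n) <= 2 * nrm (xi n) * nrm (eta n).
      by rewrite ler_wpM2r ?nrm_ge0.
    have g4 : nrm (xi n) * defect a (eta n) <= nrm (xi n) * (2 * nrm (eta n)).
      by rewrite ler_wpM2l ?nrm_ge0.
    have := sqr_ge0 (nrm (xi n) - nrm (eta n)); nra.
  rewrite -mulr_sumr big_split /= => tail.
  have s1 := N1P _ (leq_maxl _ _) _ Nk; have s2 := N2P _ (leq_maxr _ _) _ Nk.
  have : 2 * B * (\sum_(N <= i < k) nrm (xi i) ^+ 2 + \sum_(N <= i < k) nrm (eta i) ^+ 2)
      <= 2 * B * (d / (2 * B) + d / (2 * B)).
    by rewrite ler_wpM2l ?mulr_ge0 ?(ltW B0) // lerD.
  have -> : 2 * B * (d / (2 * B) + d / (2 * B)) = 2 * d.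
    by field; rewrite gt_eqF.
  lra.
have -> : l1 - z * w = (S1 - z * S2) - (S1 - l1) + z * (S2 - w) by ring.
have h3 : nrm (z * (S2 - w)) <= d.
  rewrite nrmM; apply: (@le_trans _ _ ((nrm z + 1) * nrm (S2 - w))).
    by rewrite ler_wpM2r ?nrm_ge0 // lerDl.
  by rewrite -ler_pdivlMl // mulrC ltW.
rewrite (le_lt_trans (nrmD _ _)) //.
have h4 := nrmB (S1 - z * S2) (S1 - l1).
rewrite /d in tail h1 h3; lra.
Qed.
End Invariance.
End Coamenability.

Theorem theorem4p7 (R : realType)
    (* the algebraic quantum group, with its co-unit and antipode *)
    (A : starAlgType R[i]) (Delta : A -> multiplier (tensor A A))
    (phi eps : {scalar A}) (S : {linear A -> A})
    (Delta_mH : multiplier_Hopf Delta)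
    (phi_Haar : left_Haar_integral Delta phi)
    (eps_counit : counit Delta eps) (S_antipode : antipode Delta eps S)
    (* its GNS pair and representation *)
    (H : hilbert R) (Lambda : {linear A -> H}) (rep : A -> H -> H)
    (Lambda_GNS : GNS_pair phi Lambda) (rep_GNS : GNS_representation Lambda rep)
    (* the Hilbert space tensor product of H with itself, and W *)
    (K : hilbert R) (t : H -> H -> K) (W Wadj : K -> K)
    (t_tensor : hilbert_tensor t)
    (W_mu : multiplicative_unitary Delta Lambda t W Wadj)
    (* the representation of the dual on H *)
    (drep : (A -> R[i]) -> H -> H)
    (drep_dual : dual_representation Delta phi S Lambda drep) :
  coamenable eps rep ->
  amenable t (dual_vN phi drep) (dual_comult t W Wadj).
Proof.
move=> coam.
have [U [U_ultra U_unit U_eps]] := approximate_ultrafilter Lambda_GNS rep_GNS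
  (counitM eps_counit) (counit_star eps_counit) (counit1 eps_counit) coam.
pose vec (T : H -> H) a : R[i] := ip (T (Lambda a)) (Lambda a).
(* The default 0 is taken only where the limit does not exist; for bounded operators it exists. *)
pose m T := xget 0 [set z | ulim U (vec T) z].
have mE T z : ulim U (vec T) z -> m T = z.
  by move=> Tz; apply: xget_unique => // w /(ulim_unique _ Tz) ->.
have mP T : bounded_op T -> ulim U (vec T) (m T).
  move=> /bounded_op_nrm [B B0 TB]; apply: xgetPex; apply: (@ultra_lim _ _ _ _ B).
  apply: filterS U_unit => a a1; apply: le_trans (CauchySchwarz_nrm _ _) _.
  by rewrite a1 mulr1 (le_trans (TB _)) // a1 mulr1.
(* Membership of the identity allows the series of the normal functional to be evaluated at
   [idfun]. *)
have id_vN : dual_vN phi drep idfun.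
  by split=> [|T _]; [split => // u; exact: cvg_id|].
exists m; split.
  split.
  - move=> k T T' [Tb _] [Tb' _]; apply: mE.
    have -> : vec (fun u => k *: T u + T' u) = fun a => k * vec T a + vec T' a.
      by apply: funext => a; rewrite /vec ipDl ipZl.
    by apply: ulim_linear; exact: mP.
  - move=> T [Tb _] T0; apply: ulim_ge0 (mP T Tb) => a; exact: T0.
  - apply: mE; apply: ulim_near_cst; apply: filterS U_unit => a a1.
    by rewrite /vec ip_nrm a1 expr1n.
move=> x _ w y [xb _] [x1 [x_amp ->]] _ [yb [xi [eta [[xi_sum eta_sum w_lim] y_lim]]]].
apply: mE.
(* Along [U], [vec y - vec x * w idfun] tends to 0; adding [w idfun * vec x] identifies the limit of
   [vec y] as [w idfun * m x]. *)
have := slice_mean Delta_mH eps_counit Lambda_GNS t_tensor W_mu U_ultra U_unit U_eps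
  x_amp xi_sum eta_sum (w_lim _ id_vN) y_lim.
move=> /(ulim_linear (w idfun) _ (mP x xb)); rewrite addr0.
suff -> : (fun a => w idfun * vec x a + (ip (y (Lambda a)) (Lambda a) -
  ip (x (Lambda a)) (Lambda a) * w idfun)) = vec y by [].
by apply: funext => a; rewrite /vec; ring.
Qed.
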